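(* Let $X=X(\Omega,\mu)$ be a Banach lattice, let $(\psi_k)_{k=0}^\infty$ with $\psi_0=1$ be an orthonormal system in $L_2(\Omega,\mu)$, let $\Psi_n\subset X$ be the span of $(\psi_k)_{k=0}^n$, and let $S_nf=\sum_{k=0}^n(f,\psi_k)\psi_k$. Assume that, for a given $n\in\mathbb{N}$, the following conditions hold: 1) there exist $(x_k)_{k=1}^N$ and $(\mu_k)_{k=1}^N$, $\mu_k\ge0$, such that $$\int_\Omega P_n(x)Q_n(x)\,d\mu(x)=\sum_{k=1}^NP_n(x_k)Q_n(x_k)\mu_k\quad\text{for all }P_n,Q_n\in\Psi_n;$$ 2) there exist $\Omega_k\subset\Omega$, $k=1,\dots,N$, and absolute constants $c_1$ and $c_2$ such that $$\mu_k\le c_1\int_{\Omega_k}d\mu(x),\quad k=1,\dots,N,\qquad\text{and}\qquad\sum_{k=1}^N\chi_{\Omega_k}(x)\le c_2\quad\text{for all }x\in\Omega;$$ 3) there exists $C_1>0$ such that $\|S_ng\|_X\le C_1\|g\|_X$ for all $g\in X$; 4) there exist $\beta>0$ and a non-negative function $\varphi_n$ on $\Omega$ such that for all $\alpha\in\mathbb{Z}_+^d$ $$\|\varphi_n^{|\alpha|_1}D^\alpha P_n\|_Y\le B_\alpha n^{\beta|\alpha|_1}\|P_n\|_Y,\quad P_n\in\Psi_n,\quad Y\in\{X,X'\},$$ with $B_\alpha>0$; 5) there exists $A>0$ such that $\eta=\sum_{\alpha\in\mathbb{Z}_+^d\setminus\{0\}}\frac{A^{|\alpha|_1}B_\alpha}{\alpha!}<\infty$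 and, for each $k=1,\dots,N$, $$x_k\in Q\left(x,\tfrac{A}{n^\beta}\varphi_n(x)\right)\quad\text{for all }x\in\Omega_k.$$ Then, for all $P_n\in\Psi_n$, we have $$\frac1{c_2(1+\eta)}\bigg\|\sum_{k=1}^N|P_n(x_k)|\chi_{\Omega_k}\bigg\|_X\le\|P_n\|_X\le c_1c_2C_1(1+\eta)\bigg\|\sum_{k=1}^N|P_n(x_k)|\chi_{\Omega_k}\bigg\|_X .$$
   Context: $\Omega\subset\mathbb{R}^d$ is a non-empty domain with a positive $\sigma$-finite measure $\mu$, and $(f,g)=\int_\Omega f\overline{g}\,d\mu$ is the inner product of $L_2(\Omega,\mu)$. A Banach (function) lattice $X=X(\Omega,\mu)$ is a Banach space of functions on $\Omega$ with a functional $\|\cdot\|_X$ such that: 1) $\|f\|_X=0$ iff $f=0$; 2) $\|\lambda f\|_X=|\lambda|\|f\|_X$ for $\lambda\in\mathbb{C}$; 3) $\|f+g\|_X\le\|f\|_X+\|g\|_X$; 4) if $|f|\le|g|$ then $\|f\|_X\le\|g\|_X$ for $f,g\in X$; 5) $\chi_B\in X$ for all $B\subset\Omega$ with $\mu(B)<\infty$; moreover $X\subset L_1$ is assumed. $X'$ is the associate space of $X$, with norm $\|g\|_{X'}=\sup_{\|f\|_X\le1}\int_\Omega g(x)\overline{f(x)}\,d\mu(x)$. The function class $\Psi_n$ consists of continuous, infinitely differentiable functions. $|\alpha|_1=\alpha_1+\dots+\alpha_d$, $\alpha!=\alpha_1!\cdots\alpha_d!$, $D^\alpha=\partial^{|\alpha|_1}/\partial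 x_1^{\alpha_1}\cdots\partial x_d^{\alpha_d}$. $Q(x,\delta)=\{y\in\Omega:\|x-y\|_\infty\le\delta\}$. $\chi_E$ is the indicator function of $E$.
   Formalization: Condition 1 is assumed with P_n times the complex conjugate of Q_n on both sides instead of P_nQ_n; and it is additionally assumed that, for P in Ψ_n and x in Ω_k, if the Taylor series of P at x converges absolutely at x_k, then its sum is P(x_k). *)

(* Defs.v *)
From HB Require Import structures.
From mathcomp Require Import all_boot all_order all_algebra.
From mathcomp Require Export complex.
From mathcomp Require Import all_classical all_reals all_analysis.

Set Implicit Arguments.
Unset Strict Implicit.
Unset Printing Implicit Defensive.

Import Order.TTheory GRing.Theory Num.Theory numFieldNormedType.Exports.

Local Open Scope classical_set_scope.
Local Open Scope ring_scope.

Definition Psi {T : Type} {R : realType} (psi : nat -> T -> R[i]) (n : nat) : set (T -> R[i]) :=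
  [set P | exists a : 'I_n.+1 -> R[i],
     P = (fun x => \sum_(k < n.+1) a k * psi k x)].

Section complex_functions.
Context {disp : measure_display} {T : measurableType disp} {R : realType}.
Variables (mu : {measure set T -> \bar R}) (Omega : set T).
Implicit Types f g : T -> R[i].

Definition cmeasurable f :=
  measurable_fun Omega (fun x => complex.Re (f x)) /\
  measurable_fun Omega (fun x => complex.Im (f x)).

Definition cintegrable f :=
  mu.-integrable Omega (fun x => (complex.Re (f x))%:E) /\
  mu.-integrable Omega (fun x => (complex.Im (f x))%:E).

(* Rintegral is total: the value is meaningful only when f is cintegrable. *)
Definition cintegral f : R[i] :=
  Complex (\int[mu]_(x in Omega) complex.Re (f x))
          (\int[mu]_(x in Omega) complex.Im (f x)).

Definition cinner f g : R[i] := cintegral (fun x => f x * conjc (g x)).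

Definition square_integrable f :=
  cmeasurable f /\
  (\int[mu]_(x in Omega) (Normc.normc (f x) ^+ 2)%:E < +oo)%E.

Definition orthonormal_system (psi : nat -> T -> R[i]) :=
  (forall k, square_integrable (psi k)) /\
  (forall j k, cinner (psi j) (psi k) = (j == k)%:R).

(* Elements are functions on the whole of T, but only their values on Omega
   matter, and only up to mu-null sets (bl_ae).  Monotonicity of the norm
   compares elements of X only: X is a lattice (bl_abs), but a measurable
   function dominated by an element of X need not belong to X.
   The value of bl_norm outside X is irrelevant. *)
Record banach_lattice := BanachLattice {
  bl_mem : set (T -> R[i]) ;
  bl_norm : (T -> R[i]) -> R ;
  bl_measurable : forall f, bl_mem f -> cmeasurable f ;
  bl_ae : forall f g, bl_mem f -> cmeasurable g ->
    {ae mu, forall x, Omega x -> f x = g x} -> bl_mem g ;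
  bl_add : forall f g, bl_mem f -> bl_mem g -> bl_mem (fun x => f x + g x) ;
  bl_scale : forall (a : R[i]) f, bl_mem f -> bl_mem (fun x => a * f x) ;
  bl_abs : forall f, bl_mem f -> bl_mem (fun x => `|f x|) ;
  bl_norm_eq0 : forall f, bl_mem f ->
    bl_norm f = 0 <-> {ae mu, forall x, Omega x -> f x = 0} ;
  bl_normZ : forall (a : R[i]) f, bl_mem f ->
    bl_norm (fun x => a * f x) = Normc.normc a * bl_norm f ;
  bl_normD : forall f g, bl_mem f -> bl_mem g ->
    bl_norm (fun x => f x + g x) <= bl_norm f + bl_norm g ;
  bl_norm_le : forall f g, bl_mem f -> bl_mem g ->
    {ae mu, forall x, Omega x -> `|f x| <= `|g x|} ->
    bl_norm f <= bl_norm g ;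
  bl_indic : forall B, measurable B -> B `<=` Omega -> (mu B < +oo)%E ->
    bl_mem (fun x => real_complex R (\1_B x)) ;
  bl_complete : forall u : nat -> T -> R[i], (forall m, bl_mem (u m)) ->
    (forall e : R, 0 < e -> exists M, forall m p, (M <= m)%N -> (M <= p)%N ->
       bl_norm (fun x => u m x - u p x) < e) ->
    exists2 f, bl_mem f &
      (fun m => bl_norm (fun x => u m x - f x)) @ \oo --> (0 : R) ;
  bl_L1 : forall f, bl_mem f -> cintegrable f
}.

Definition assoc_norm (X : banach_lattice) g : \bar R :=
  ereal_sup [set (Normc.normc (cinner g f))%:E |
             f in [set f | bl_mem X f /\ bl_norm X f <= 1]].

Definition assoc_mem (X : banach_lattice) : set (T -> R[i]) :=
  [set g | [/\ cmeasurable g,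
               forall f, bl_mem X f -> cintegrable (fun x => g x * conjc (f x))
             & (assoc_norm X g < +oo)%E]].

Definition partial_sum (psi : nat -> T -> R[i]) (n : nat) f : T -> R[i] :=
  fun x => \sum_(k < n.+1) cinner f (psi k) * psi k x.

End complex_functions.

Section multi_indices.
Context {d : nat}.
Implicit Type a : {ffun 'I_d -> nat}.

Definition mdeg a : nat := (\sum_(i < d) a i)%N.
Definition mfact a : nat := (\prod_(i < d) (a i)`!)%N.
Definition mpow {K : comNzRingType} (v : 'rV[K]_d) a : K :=
  \prod_(i < d) v ord0 i ^+ a i.

End multi_indices.

Section differentiation.
Context {R : realType} {d : nat}.
Implicit Types (u : 'rV[R]_d -> R) (P : 'rV[R]_d -> R[i]).
Implicit Type a : {ffun 'I_d -> nat}.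

Definition pderiv (i : 'I_d) u : 'rV[R]_d -> R :=
  fun x => 'D_(delta_mx ord0 i) u x.

(* pderivs [:: i1; ...; im] u = d/dx_i1 ... d/dx_im u *)
Definition pderivs (s : seq 'I_d) u : 'rV[R]_d -> R := foldr pderiv u s.

Definition smooth_on (Omega : set 'rV[R]_d) P :=
  forall (s : seq 'I_d) (u : 'rV[R]_d -> R),
    u = (fun y => complex.Re (P y)) \/ u = (fun y => complex.Im (P y)) ->
    forall x, Omega x ->
      {for x, continuous (pderivs s u)} /\
      (forall i, derivable (pderivs s u) x (delta_mx ord0 i)).

Definition mindex_seq a : seq 'I_d :=
  flatten [seq nseq (a i) i | i <- enum 'I_d].

Definition Dalpha a P : 'rV[R]_d -> R[i] := fun x =>
  Complex (pderivs (mindex_seq a) (fun y => complex.Re (P y)) x)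
          (pderivs (mindex_seq a) (fun y => complex.Im (P y)) x).

Definition taylor_term P (x y : 'rV[R]_d) a : R[i] :=
  Dalpha a P x * real_complex R (mpow (y - x) a / (mfact a)%:R).

(* The bounded functions {ffun 'I_d -> 'I_m.+1} include all multi-indices of
   degree at most m. *)
Definition taylor_poly P (m : nat) (x y : 'rV[R]_d) : R[i] :=
  \sum_(b : {ffun 'I_d -> 'I_m.+1} | (\sum_(i < d) b i <= m)%N)
    taylor_term P x y [ffun i => nat_of_ord (b i)].

(* If the Taylor series of P at x converges absolutely at y, its sum is P y. *)
Definition taylor_represents P (x y : 'rV[R]_d) :=
  (\esum_(a in [set: {ffun 'I_d -> nat}])
     (Normc.normc (taylor_term P x y a))%:E < +oo)%E ->
  (fun m => Normc.normc (taylor_poly P m x y - P y)) @ \oo --> (0 : R).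

(* The norm of a row vector is the maximum norm. *)
Definition cube (Omega : set 'rV[R]_d) (x : 'rV[R]_d) (delta : R) :
  set 'rV[R]_d := [set y | Omega y /\ `|x - y| <= delta].

End differentiation.

(* Main.v *)
Require Import Defs.
From HB Require Import structures.
From mathcomp Require Import all_boot all_order all_algebra.
From mathcomp Require Import complex.
From mathcomp Require finmap.
From mathcomp Require Import all_classical all_reals all_analysis.
From mathcomp Require Import measurable_realfun ring lra.

(** The lower bound: for [x] in [Omega_k] the Taylor expansion of [P] at [x]
    bounds [|P x_k|] by the sum of the terms
    [(A / n^beta)^|a| / a! * |phi^|a| D^a P|] at [x].  By Bernstein's inequality
    this series of elements of [X] is absolutely convergent with total norm at
    most [(1 + eta) |P|], and since its partial sums increase, its norm limit
    dominates them almost everywhere.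

    The upper bound: no Fatou property of [X] is available, so the norm of [X]
    need not be the dual norm of [X'].  Instead, a norming functional for [P] on
    the finite-dimensional space [(Psi_n, |.|_X)], given by the Hahn-Banach
    theorem, is represented as [(., Q)] with [Q] in [Psi_n].  From
    [(f, Q) = (S_n f, Q)] one gets [|Q|_X' <= C1], and the quadrature formula,
    the Taylor expansion of [Q] and Bernstein's inequality in [X'] give
    [|P| = (P, Q) <= c1 * (1 + eta) * |F| * |Q|_X'].  The constant [c2] enters
    here only through [1 <= c2]. *)

Set Implicit Arguments.
Unset Strict Implicit.
Unset Printing Implicit Defensive.

Import Order.TTheory GRing.Theory Num.Theory numFieldNormedType.Exports.
Local Open Scope classical_set_scope.
Local Open Scope ring_scope.
Local Open Scope complex_scope.

(** * The complex modulus as a real number *)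

Section complex_modulus.
Context {R : realType}.
Implicit Types (z w : R[i]) (r : R).

Lemma complex_normE z : `|z| = (Normc.normc z)%:C.
Proof. by []. Qed.

Lemma normc_ge0 z : 0 <= Normc.normc z.
Proof. by rewrite -ler0c -complex_normE. Qed.

Lemma normcR r : Normc.normc r%:C = `|r|.
Proof. by rewrite /Normc.normc/= expr0n/= addr0 sqrtr_sqr. Qed.

Lemma normc_conjc z : Normc.normc (conjc z) = Normc.normc z.
Proof. by case: z => a b /=; rewrite sqrrN. Qed.

Lemma conjcM z w : conjc (z * w) = conjc z * conjc w.
Proof. exact: rmorphM. Qed.

Lemma mulc_conjc z : z * conjc z = (Normc.normc z ^+ 2)%:C.
Proof. by rewrite -sqr_normc complex_normE -(rmorphXn (real_complex R)). Qed.

Lemma normcB z w : Normc.normc (z - w) = Normc.normc (w - z).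
Proof. by rewrite -normcN opprB. Qed.

Lemma Re_le_normc z : complex.Re z <= Normc.normc z.
Proof. by apply: (le_trans (ler_norm _)); rewrite -lecR -complex_normE normc_ge_Re. Qed.

Lemma abs_Re_le_normc z : `|complex.Re z| <= Normc.normc z.
Proof. by rewrite -lecR -complex_normE normc_ge_Re. Qed.

Lemma abs_Im_le_normc z : `|complex.Im z| <= Normc.normc z.
Proof.
case: z => a b /=; rewrite -sqrtr_sqr; apply: ler_wsqrtr.
by rewrite lerDr sqr_ge0.
Qed.

Lemma ler_normc_sum (I : Type) (s : seq I) (p : pred I) (F : I -> R[i]) :
  Normc.normc (\sum_(i <- s | p i) F i) <=
  \sum_(i <- s | p i) Normc.normc (F i).
Proof.
elim/big_ind2 : _ => [|x y x' y' h h'|//]; first by rewrite Normc.normc0.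
by apply: le_trans (le_normcD _ _) _; apply: lerD.
Qed.

End complex_modulus.

(** * Elementary properties of Banach lattices, and norm limits *)

Section banach_lattice_theory.
Context {disp : measure_display} {T : measurableType disp} {R : realType}.
Context {mu : {measure set T -> \bar R}} {Omega : set T}.
Variable X : banach_lattice mu Omega.
Implicit Types (f g h : T -> R[i]) (u v : T -> R).

Local Notation bl_memR u := (bl_mem X (fun x => (u x)%:C)).
Local Notation bl_normR u := (bl_norm X (fun x => (u x)%:C)).

Lemma bl_mem0 : bl_mem X (fun=> 0).
Proof.
rewrite (_ : (fun=> _) = (fun x => real_complex R (\1_set0 x))); last first.
  by apply/funext => x; rewrite indic0.
by apply: bl_indic => //; rewrite measure0.
Qed.

Lemma bl_norm0 : bl_norm X (fun=> 0) = 0.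
Proof. by apply/(bl_norm_eq0 bl_mem0); apply: nearW. Qed.

Lemma bl_norm_ge0 f : bl_mem X f -> 0 <= bl_norm X f.
Proof.
move=> Xf; rewrite -bl_norm0; apply: bl_norm_le => //; first exact: bl_mem0.
by apply: nearW => x _; rewrite normr0 normr_ge0.
Qed.

Lemma bl_memN f : bl_mem X f -> bl_mem X (fun x => - f x).
Proof. by move=> /(@bl_scale _ _ _ _ _ X (-1)); under eq_fun do rewrite mulN1r. Qed.

Lemma bl_normN f : bl_mem X f -> bl_norm X (fun x => - f x) = bl_norm X f.
Proof.
move=> /(@bl_normZ _ _ _ _ _ X (-1)); under eq_fun do rewrite mulN1r.
by rewrite normcN Normc.normc1 mul1r.
Qed.

Lemma bl_memB f g : bl_mem X f -> bl_mem X g -> bl_mem X (fun x => f x - g x).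
Proof. by move=> Xf Xg; apply: bl_add => //; exact: bl_memN. Qed.

Lemma bl_norm_ler f g : bl_mem X f -> bl_mem X g ->
  (forall x, Omega x -> Normc.normc (f x) <= Normc.normc (g x)) ->
  bl_norm X f <= bl_norm X g.
Proof.
move=> Xf Xg fg; apply: bl_norm_le => //; apply: nearW => x Ox.
by rewrite !complex_normE lecR fg.
Qed.

Lemma bl_norm_abs f : bl_mem X f ->
  bl_norm X (fun x => (Normc.normc (f x))%:C) = bl_norm X f.
Proof.
move=> Xf; apply/eqP; rewrite eq_le; apply/andP; split; apply: bl_norm_ler => //;
  try exact: bl_abs; by move=> x _; rewrite normcR ger0_norm ?normc_ge0.
Qed.

Lemma bl_mem_sum (I : Type) (s : seq I) (p : pred I) (F : I -> T -> R[i]) :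
  (forall i, p i -> bl_mem X (F i)) ->
  bl_mem X (fun x => \sum_(i <- s | p i) F i x).
Proof.
move=> XF; elim: s => [|i s ih].
  rewrite (_ : (fun x => \sum_(j <- [::] | p j) F j x) = fun=> 0); first exact: bl_mem0.
  by apply/funext => x; rewrite big_nil.
rewrite (_ : (fun x => \sum_(j <- i :: s | p j) F j x) =
    fun x => (if p i then F i x else 0) +
    \sum_(j <- s | p j) F j x); last first.
  by apply/funext => x; rewrite big_cons; case: ifP => // _; rewrite add0r.
by apply: bl_add => //; case pi: (p i); [exact: XF|exact: bl_mem0].
Qed.

Lemma bl_norm_sum (I : Type) (s : seq I) (p : pred I) (F : I -> T -> R[i]) :
  (forall i, p i -> bl_mem X (F i)) ->
  bl_norm X (fun x => \sum_(i <- s | p i) F i x) <=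
  \sum_(i <- s | p i) bl_norm X (F i).
Proof.
move=> XF; elim: s => [|i s ih].
  rewrite big_nil (_ : (fun x => \sum_(j <- [::] | p j) F j x) = fun=> 0) ?bl_norm0//.
  by apply/funext => x; rewrite big_nil.
rewrite big_cons; case: ifPn => pi; last first.
  rewrite (_ : (fun x => \sum_(j <- i :: s | p j) F j x) =
      fun x => \sum_(j <- s | p j) F j x)//.
  by apply/funext => x; rewrite big_cons (negbTE pi).
rewrite (_ : (fun x => \sum_(j <- i :: s | p j) F j x) =
    fun x => F i x + \sum_(j <- s | p j) F j x).
  apply: le_trans (bl_normD _ _) _; [exact: XF|exact: bl_mem_sum|].
  by rewrite lerD2l.
by apply/funext => x; rewrite big_cons pi.
Qed.

Lemma bl_memRD u v : bl_memR u -> bl_memR v -> bl_memR (fun x => u x + v x).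
Proof. by move=> Xu Xv; under eq_fun do rewrite rmorphD; exact: bl_add. Qed.

Lemma bl_memRZ (a : R) u : bl_memR u -> bl_memR (fun x => a * u x).
Proof. by move=> Xu; under eq_fun do rewrite rmorphM; exact: bl_scale. Qed.

Lemma bl_memRB u v : bl_memR u -> bl_memR v -> bl_memR (fun x => u x - v x).
Proof. by move=> Xu Xv; under eq_fun do rewrite rmorphB; exact: bl_memB. Qed.

Lemma bl_memR_normc f : bl_mem X f -> bl_memR (fun x => Normc.normc (f x)).
Proof. exact: bl_abs. Qed.

Lemma bl_memR_norm u : bl_memR u -> bl_memR (fun x => `|u x|).
Proof. by move=> /bl_memR_normc; under eq_fun do rewrite normcR. Qed.

Lemma bl_memR_max0 u : bl_memR u -> bl_memR (fun x => Num.max (u x) 0).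
Proof.
move=> Xu; rewrite (_ : (fun x => _) = (fun x => (2^-1 * (`|u x| + u x))%:C)).
  by apply: bl_memRZ; apply: bl_memRD => //; exact: bl_memR_norm.
apply/funext => x; congr (_%:C); case: (leP (u x) 0) => u0.
  by rewrite ler0_norm// addNr mulr0.
by rewrite gtr0_norm//; field.
Qed.

Lemma bl_normR_eq0 u : bl_memR u -> bl_normR u = 0 ->
  {ae mu, forall x, Omega x -> u x = 0}.
Proof.
move=> Xu /(bl_norm_eq0 Xu); apply: filterS => x h Ox.
by apply: complexI; exact: h.
Qed.

(** Monotonicity bounds the norm of [v] by that of [u p - f] for all [p >= m], and these norms tend
    to 0. Taking for [v] a positive part turns norm convergence into inequalities almost
    everywhere. *)
Lemma bl_cvg_dominated (u : nat -> T -> R[i]) f v (m : nat) :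
  (forall p, bl_mem X (u p)) -> bl_mem X f -> bl_memR v ->
  (fun p => bl_norm X (fun x => u p x - f x)) @ \oo --> (0 : R) ->
  (forall p x, (m <= p)%N -> Omega x -> `|v x| <= Normc.normc (u p x - f x)) ->
  {ae mu, forall x, Omega x -> v x = 0}.
Proof.
move=> Xu Xf Xv uf vuf; apply: bl_normR_eq0 => //.
apply/eqP; rewrite eq_le bl_norm_ge0// andbT.
apply: (cvgr_to_ge uf); exists m => // p /= mp.
apply: bl_norm_ler => [//||x Ox]; first exact: bl_memB.
by rewrite normcR; exact: vuf.
Qed.

(** Take for [h] the norm limit of the Cauchy sequence [u]. For [p >= m] the positive part of
    [u m - |h|] is at most [|u p - h|], so it vanishes almost everywhere. The bound [K] passes to
    [h] by the triangle inequality. *)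
Lemma bl_nondecreasing_dominated (u : nat -> T -> R) (K : R) :
  (forall m, bl_memR (u m)) ->
  (forall m p x, (m <= p)%N -> Omega x -> u m x <= u p x) ->
  (forall e : R, 0 < e -> exists M, forall m p, (M <= m)%N -> (M <= p)%N ->
     bl_normR (fun x => u m x - u p x) < e) ->
  (forall m, bl_normR (u m) <= K) ->
  exists h, [/\ bl_mem X h, bl_norm X h <= K &
    forall m, {ae mu, forall x, Omega x -> u m x <= Normc.normc (h x)}].
Proof.
move=> Xu ndu cu uK.
have [|h Xh uh] := @bl_complete _ _ _ _ _ X (fun m x => (u m x)%:C) Xu.
  move=> e /cu[M uM]; exists M => m p Mm Mp; have := uM _ _ Mm Mp.
  by rewrite (_ : (fun x => _) = fun x => (u m x)%:C - (u p x)%:C)//;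
    apply/funext => x; rewrite rmorphB.
exists h; split => //.
- rewrite -[K]addr0; apply: (cvgr_to_ge (cvgD (@cvg_cst _ K _ \oo _) uh)).
  apply: nearW => p; rewrite /= (_ : h = fun x => (u p x)%:C - ((u p x)%:C - h x)).
    apply: le_trans (bl_normD _ _) _ => //; first exact/bl_memN/bl_memB.
    rewrite bl_normN; last exact: bl_memB.
    under [X in _ <= _ + bl_norm _ X]eq_fun do rewrite subKr.
    exact: lerD.
  by apply/funext => x; rewrite subKr.
- move=> m.
  have Xw : bl_memR (fun x => u m x - Normc.normc (h x)).
    by apply: bl_memRB => //; exact: bl_memR_normc.
  apply: filterS (@bl_cvg_dominated _ h _ m Xu Xh (bl_memR_max0 Xw) uh _).
    by move=> x uh0 Ox; rewrite -subr_le0 -[leRHS](uh0 Ox) le_max lexx.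
  move=> p x mp Ox; rewrite ger0_norm ?le_max ?lexx ?orbT//.
  rewrite ge_max normc_ge0 andbT lerBlDr (le_trans (ndu _ _ _ mp Ox))//.
  apply: le_trans (le_normcD _ _); rewrite subrK normcR; exact: ler_norm.
Qed.

End banach_lattice_theory.

(** * Uniform limits on a set of finite measure *)

Lemma ltr_div_archi (R : realType) (c e : R) : 0 < e ->
  exists M, forall m, (M <= m)%N -> c / m.+1%:R < e.
Proof.
move=> e0; exists (Num.truncn (c / e)) => m Mm.
rewrite ltr_pdivrMr ?ltr0n// mulrC -ltr_pdivrMr//.
by apply: (lt_le_trans (truncnS_gt _)); rewrite ler_nat.
Qed.

(** The sum [s] counts the positive integers up to [y]; as [y <= N], it is the integer part of
    [y]. *)
Lemma sum_layer_cake (R : realType) (N : nat) (y : R) : 0 <= y <= N%:R ->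
  let s : R := \sum_(j < N) (j.+1%:R <= y)%R%:R in s <= y <= s + 1.
Proof.
move=> /andP[y0 yN] /=.
(* The upper estimate may fail for a truncation [M] below [y], so the induction carries an
   alternative: either all integers up to [M] are counted, or the count has already stopped. *)
suff /(_ N)[sy [sN|/andP[_ /ltW ys]]] : forall M,
    let s : R := \sum_(j < M) (j.+1%:R <= y)%R%:R in
    s <= y /\ (s = M%:R \/ (s + 1 <= M%:R) && (y < s + 1)).
- by rewrite sy/= sN (le_trans yN)// lerDl.
- by rewrite sy.
elim=> [|M]; first by rewrite big_ord0; split=> //; left.
rewrite big_ord_recr/=; set s := \sum_(j < M) _ => -[sy [sM|/andP[sM ys]]].
  rewrite sM in sy *; have [yM|yM] := leP M.+1%:R y.
    by rewrite natr1; split=> //; left.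
  by rewrite addr0 natr1; split=> //; right; rewrite lexx.
rewrite (_ : (M.+1%:R <= y) = false); last first.
  by apply/negbTE; rewrite -ltNge (lt_trans ys)// (le_lt_trans sM)// ltr_nat.
by rewrite addr0; split=> //; right; rewrite ys andbT (le_trans sM)// ler_nat.
Qed.

Section bl_uniform_limits.
Context {disp : measure_display} {T : measurableType disp} {R : realType}.
Context {mu : {measure set T -> \bar R}} {Omega : set T}.
Hypothesis mOmega : measurable Omega.
Hypothesis Omega_fin : (mu Omega < +oo)%E.
Variable X : banach_lattice mu Omega.
Implicit Types (f g h : T -> R[i]) (u v : T -> R).

Local Notation bl_memR u := (bl_mem X (fun x => (u x)%:C)).
Local Notation bl_normR u := (bl_norm X (fun x => (u x)%:C)).

Lemma bl_norm_bounded f (c : R) : bl_mem X f -> 0 <= c ->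
  (forall x, Omega x -> Normc.normc (f x) <= c) ->
  bl_norm X f <= c * bl_normR (\1_Omega).
Proof.
move=> Xf c0 fc; have X1 : bl_memR (\1_Omega) by exact: bl_indic.
have -> : c = Normc.normc c%:C by rewrite normcR ger0_norm.
rewrite -bl_normZ//; apply: bl_norm_ler => //; first exact: bl_scale.
move=> x Ox; rewrite Normc.normcM !normcR indicE mem_set// normr1 mulr1.
by rewrite ger0_norm// fc.
Qed.

(** The indicator of [Omega] has finite norm, so uniform closeness makes [u] Cauchy in [X], with a
    norm limit [h]. It remains to identify [h] with [f] almost everywhere. *)
Lemma bl_mem_uniform_limit (u : nat -> T -> R[i]) f :
  (forall m, bl_mem X (u m)) -> cmeasurable Omega f ->
  (forall m x, Omega x -> Normc.normc (u m x - f x) <= m.+1%:R^-1) ->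
  bl_mem X f.
Proof.
move=> Xu mf uf.
pose K := bl_normR (\1_Omega).
have K0 : 0 <= K by apply: bl_norm_ge0; exact: bl_indic.
have uu m p x : Omega x ->
    Normc.normc (u m x - u p x) <= m.+1%:R^-1 + p.+1%:R^-1.
  move=> Ox; rewrite -(subrK (f x) (u m x)) -addrA.
  apply: le_trans (le_normcD _ _) _; apply: lerD; first exact: uf.
  by rewrite normcB uf.
have [|h Xh uh] := @bl_complete _ _ _ _ _ X u Xu.
  move=> e e0; have [M MK] := ltr_div_archi (2 * K) e0; exists M => m p Mm Mp.
  apply: (@le_lt_trans _ _ ((M.+1%:R^-1 + M.+1%:R^-1) * K)).
    apply: bl_norm_bounded; [exact: bl_memB|by rewrite addr_ge0|].
    move=> x Ox; apply: (le_trans (uu _ _ _ Ox)).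
    by apply: lerD; rewrite lef_pV2 ?posrE ?ltr0n// ler_nat ltnS.
  by rewrite (_ : _ * K = 2 * K / M.+1%:R); [exact: MK|ring].
apply: (bl_ae Xh) => //.
(* For [p >= m] the distance from [u m] to [u p] is at most [2 / (m + 1)]; this estimate survives in
   the norm limit [h], as the excess of [|u m - h|] over it is at most [|u p - h|]. *)
suff : {ae mu, forall x, forall m, Omega x ->
    Normc.normc (u m x - h x) <= 2 * m.+1%:R^-1}.
  apply: filterS => x uhx Ox; apply/eqP; rewrite -subr_eq0; apply/eqP.
  apply: Normc.eq0_normc; apply/eqP; rewrite eq_le normc_ge0 andbT.
  apply/ler_addgt0Pl => e e0; rewrite addr0.
  have [M M3] := ltr_div_archi 3 e0.
  apply: le_trans (ltW (M3 M (leqnn _))).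
  rewrite -(subrK (u M x) (h x)) -addrA; apply: le_trans (le_normcD _ _) _.
  rewrite [X in X + _]normcB.
  rewrite (_ : 3 / _ = 2 / M.+1%:R + M.+1%:R^-1); last by ring.
  by apply: lerD; [exact: uhx|exact: uf].
apply: ae_foralln => m.
have Xw : bl_memR (fun x => Normc.normc (u m x - h x) - 2 / m.+1%:R * \1_Omega x).
  apply: bl_memRB; first by apply: bl_memR_normc; exact: bl_memB.
  by apply: bl_memRZ; exact: bl_indic.
apply: filterS (@bl_cvg_dominated _ _ _ _ _ X _ h _ m Xu Xh (bl_memR_max0 Xw) uh _).
  move=> x /[swap] Ox /(_ Ox); rewrite indicE mem_set// mulr1 => uh0.
  by rewrite -subr_le0 -uh0 le_max lexx.
move=> p x mp Ox; rewrite indicE mem_set// mulr1.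
rewrite ger0_norm ?le_max ?lexx ?orbT//.
rewrite ge_max normc_ge0 andbT lerBlDl.
rewrite -(subrK (u p x) (u m x)) -addrA (le_trans (le_normcD _ _))// lerD2r.
apply: (le_trans (uu _ _ _ Ox)); rewrite [leRHS](_ : _ = m.+1%:R^-1 + m.+1%:R^-1);
  last by ring.
rewrite lerD2l.
by rewrite lef_pV2 ?posrE ?ltr0n// ler_nat ltnS.
Qed.

End bl_uniform_limits.

(** * Measurability of moduli, inverses and products *)

Section complex_measurability.
Context {disp : measure_display} {T : measurableType disp} {R : realType}.
Context {Omega : set T}.
Implicit Types (f g : T -> R[i]) (u : T -> R).

Lemma measurable_fun_normc f : cmeasurable Omega f ->
  measurable_fun Omega (fun x => Normc.normc (f x)).
Proof.
move=> [mRe mIm].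
rewrite (_ : (fun x => _) =
  (@powR R ^~ 2^-1) \o (fun x => complex.Re (f x) ^+ 2 + complex.Im (f x) ^+ 2)).
  apply: measurableT_comp; first exact: measurable_powR.
  by apply: measurable_funD; apply: measurable_funX.
apply/funext => x /=; rewrite powR12_sqrt ?addr_ge0 ?sqr_ge0//.
by case: (f x).
Qed.

Lemma measurable_fun_inv u : (forall x, 0 <= u x) -> measurable_fun Omega u ->
  measurable_fun Omega (fun x => (u x)^-1).
Proof.
move=> u0 mu; rewrite (_ : (fun x => _) = (@powR R ^~ (-1)) \o u).
  by apply: measurableT_comp => //; exact: measurable_powR.
by apply/funext => x /=; rewrite powR_inv1.
Qed.

Lemma cmeasurableZ u f : measurable_fun Omega u -> cmeasurable Omega f ->
  cmeasurable Omega (fun x => (u x)%:C * f x).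
Proof.
move=> mu [mRe mIm]; split.
  rewrite (_ : (fun x => _) = fun x => u x * complex.Re (f x)).
    exact: measurable_funM.
  by apply/funext => x; case: (f x) => a b /=; rewrite mul0r subr0.
rewrite (_ : (fun x => _) = fun x => u x * complex.Im (f x)).
  exact: measurable_funM.
by apply/funext => x; case: (f x) => a b /=; rewrite mul0r addr0.
Qed.

End complex_measurability.

(** * Bounded measurable functions in [X], and Hölder's inequality for the associate norm *)

Section bl_bounded.
Context {disp : measure_display} {T : measurableType disp} {R : realType}.
Context {mu : {measure set T -> \bar R}} {Omega : set T}.
Hypothesis mOmega : measurable Omega.
Hypothesis Omega_fin : (mu Omega < +oo)%E.
Variable X : banach_lattice mu Omega.
Implicit Types (f g h : T -> R[i]) (u v : T -> R).

Local Notation bl_memR u := (bl_mem X (fun x => (u x)%:C)).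
Local Notation bl_normR u := (bl_norm X (fun x => (u x)%:C)).

(** A function dominated by an element of [X] need not lie in [X], so membership comes from uniform
    approximation. On [Omega] the step function [a m] is the integer part of [(m + 1) u] divided by
    [m + 1], hence within [1 / (m + 1)] of [u]. *)
Lemma bl_memR_unit_interval u : measurable_fun Omega u ->
  (forall x, Omega x -> 0 <= u x <= 1) -> bl_memR u.
Proof.
move=> mu01 u01.
pose B m j := Omega `&` [set x | j.+1%:R <= m.+1%:R * u x].
pose a m x : R := m.+1%:R^-1 * \sum_(j < m.+1) \1_(B m j) x.
have mB m j : measurable (B m j).
  have : measurable_fun Omega (fun x => m.+1%:R * u x).
    by apply: measurable_funM => //; exact: measurable_cst.
  move=> /(_ mOmega `[j.+1%:R, +oo[%classic (measurable_itv _)).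
  rewrite (_ : _ `&` _ = B m j)//; apply/seteqP.
  by split => x [Ox]; rewrite /= in_itv/= andbT.
apply: (@bl_mem_uniform_limit _ _ _ _ _ mOmega Omega_fin X (fun m x => (a m x)%:C)).
- move=> m; apply: bl_memRZ.
  rewrite (_ : (fun x => _) = fun x => \sum_(j < m.+1) (\1_(B m j) x)%:C).
    apply: bl_mem_sum => j _; apply: bl_indic => //; first exact: subIsetl.
    apply: le_lt_trans Omega_fin; apply: le_measure; rewrite ?inE//.
    exact: subIsetl.
  by apply/funext => x; rewrite rmorph_sum.
- by split => //=; exact: measurable_cst.
- move=> m x Ox; rewrite -rmorphB normcR.
  have m0 : (0 : R) < m.+1%:R by rewrite ltr0n.
  have /sum_layer_cake/= : 0 <= m.+1%:R * u x <= m.+1%:R.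
    by have /andP[? ?] := u01 _ Ox; rewrite mulr_ge0//= ler_piMr.
  set s := \sum_(j < _) _; set y := _ * u x => /andP[sy ys].
  have -> : a m x = m.+1%:R^-1 * s.
    congr (_ * _); apply: eq_bigr => j _; rewrite indicE.
    case: leP => h; first by rewrite mem_set.
    by rewrite memNset// => -[_ /=]; rewrite leNgt h.
  rewrite (_ : u x = m.+1%:R^-1 * y); last by rewrite mulKf// gt_eqF.
  rewrite -mulrBr normrM gtr0_norm ?invr_gt0//.
  by rewrite ler_piMr ?invr_ge0 ?(ltW m0)// ler_norml; lra.
Qed.

(** An affine change brings [u] into the unit interval; [d] is [|c| + 1] so as to be positive for
    every [c]. *)
Lemma bl_memR_bounded u (c : R) : measurable_fun Omega u ->
  (forall x, Omega x -> `|u x| <= c) -> bl_memR u.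
Proof.
move=> mu' uc; pose d := `|c| + 1.
have d0 : 0 < d by rewrite ltr_wpDl.
have X1 : bl_memR (fun=> 1).
  apply: bl_memR_unit_interval; first exact: measurable_cst.
  by move=> x _; rewrite ler01 lexx.
have Xv : bl_memR (fun x => 2^-1 * (1 + d^-1 * u x)).
  apply: bl_memR_unit_interval.
    apply: measurable_funM; first exact: measurable_cst.
    apply: measurable_funD; first exact: measurable_cst.
    by apply: measurable_funM => //; exact: measurable_cst.
  move=> x Ox; suff : `|d^-1 * u x| <= 1 by rewrite ler_norml; lra.
  rewrite normrM gtr0_norm ?invr_gt0// ler_pdivrMl// mulr1.
  by rewrite (le_trans (uc _ Ox))// (le_trans (ler_norm c))// lerDl.
have := bl_memRB (bl_memRZ (2 * d) Xv) (bl_memRZ d X1).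
rewrite (_ : (fun x => _) = fun x => (u x)%:C)//.
by apply/funext => x; congr (_%:C); field; rewrite gt_eqF.
Qed.

Lemma bl_mem_bounded f (c : R) : cmeasurable Omega f ->
  (forall x, Omega x -> Normc.normc (f x) <= c) -> bl_mem X f.
Proof.
move=> [mRe mIm] fc.
have XRe : bl_memR (fun x => complex.Re (f x)).
  apply: (@bl_memR_bounded _ c) => // x Ox.
  exact: le_trans (abs_Re_le_normc _) (fc _ Ox).
have XIm : bl_memR (fun x => complex.Im (f x)).
  apply: (@bl_memR_bounded _ c) => // x Ox.
  exact: le_trans (abs_Im_le_normc _) (fc _ Ox).
rewrite (_ : f = fun x => (complex.Re (f x))%:C + 'i * (complex.Im (f x))%:C).
  by apply: bl_add => //; exact: bl_scale.
by apply/funext => x; rewrite -complexE.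
Qed.

Lemma assoc_norm_ub g f : bl_mem X f -> bl_norm X f <= 1 ->
  ((Normc.normc (cinner mu Omega g f))%:E <= assoc_norm X g)%E.
Proof. by move=> Xf f1; apply: ereal_sup_ubound; exists f. Qed.

Lemma assoc_norm_ge0 g : (0 <= assoc_norm X g)%E.
Proof.
apply: le_trans (assoc_norm_ub g (bl_mem0 X) _); last by rewrite bl_norm0 ler01.
by rewrite lee_fin normc_ge0.
Qed.

(** Testing [g] against a function with the phase of [g] and modulus at most [u / |u|_X] turns the
    pairing into a multiple of the integral of [u * |g|]. The bound [c] puts the test function in
    [X]. *)
Lemma assoc_hoelder g u (c : R) : assoc_mem X g -> measurable_fun Omega u ->
  (forall x, Omega x -> 0 <= u x <= c) ->
  (\int[mu]_(x in Omega) (u x * Normc.normc (g x))%:E <=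
   (bl_normR u)%:E * assoc_norm X g)%E.
Proof.
move=> [mg gI _] mu' uc.
have Xu : bl_memR u.
  apply: (@bl_memR_bounded _ c) => // x Ox.
  by have /andP[u0 ?] := uc _ Ox; rewrite ger0_norm.
have mgn := measurable_fun_normc mg.
have mug : measurable_fun Omega (fun x => (u x * Normc.normc (g x))%:E).
  by apply/measurable_EFinP; exact: measurable_funM.
(* Without normalization: [u] vanishes almost everywhere, and both sides are 0. *)
have [u0|u_neq0] := eqVneq (bl_normR u) 0.
  rewrite u0 mul0e (ae_eq_integral (cst 0%E)) ?integral0//.
  apply: filterS (bl_normR_eq0 Xu u0) => x ux Ox /=.
  by rewrite ux// mul0r.
set nu := bl_normR u in u_neq0 *.
have nu0 : 0 < nu by rewrite lt_def u_neq0 bl_norm_ge0.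
(* [f] is [u], normalized, times the sign of [g]; note that [0^-1 = 0] *)
pose f x := (nu^-1 * u x * (Normc.normc (g x))^-1)%:C * g x.
have fE x : Omega x -> Normc.normc (f x) <= nu^-1 * u x.
  move=> Ox; have /andP[ux0 _] := uc _ Ox.
  rewrite Normc.normcM normcR ger0_norm; last first.
    by rewrite !mulr_ge0 ?invr_ge0 ?normc_ge0 ?(ltW nu0).
  have [->|gx0] := eqVneq (Normc.normc (g x)) 0.
    by rewrite mulr0 mulr_ge0 ?invr_ge0 ?(ltW nu0).
  by rewrite mulfVK.
have mf : cmeasurable Omega f.
  apply: cmeasurableZ => //; apply: measurable_funM.
    by apply: measurable_funM => //; exact: measurable_cst.
  by apply: measurable_fun_inv => // x; exact: normc_ge0.
have Xf : bl_mem X f.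
  apply: (@bl_mem_bounded _ (nu^-1 * c)) => // x Ox.
  apply: (le_trans (fE _ Ox)); rewrite ler_pM2l ?invr_gt0//.
  by have /andP[] := uc _ Ox.
have f1 : bl_norm X f <= 1.
  apply: (@le_trans _ _ (bl_normR (fun x => nu^-1 * u x))).
    apply: bl_norm_ler => //; first exact: bl_memRZ.
    by move=> x Ox; rewrite normcR (le_trans (fE _ Ox))// ler_norm.
  rewrite (_ : (fun x => _) = fun x => (nu^-1)%:C * (u x)%:C).
    by rewrite bl_normZ// normcR gtr0_norm ?invr_gt0// mulVf.
  by apply/funext => x; rewrite rmorphM.
have gf x : g x * conjc (f x) = (nu^-1 * (u x * Normc.normc (g x)))%:C.
  rewrite conjcM conjc_real mulrCA mulc_conjc -(rmorphM (real_complex R)).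
  congr (_%:C); have [->|gx0] := eqVneq (Normc.normc (g x)) 0; first by ring.
  by field; rewrite gx0 gt_eqF.
have [gfI _] := gI _ Xf.
have ugI : mu.-integrable Omega (fun x => (u x * Normc.normc (g x))%:E).
  have := integrableZl mOmega nu gfI.
  apply: eq_integrable => // x _; rewrite gf /= -EFinM; congr (_%:E).
  by field; rewrite gt_eqF.
rewrite -(fineK (integrable_fin_num mOmega ugI)).
have I0 : 0 <= \int[mu]_(x in Omega) (u x * Normc.normc (g x)).
  apply: Rintegral_ge0 => x Ox; have /andP[ux0 _] := uc _ Ox.
  by rewrite mulr_ge0// normc_ge0.
have := assoc_norm_ub g Xf f1.
rewrite (_ : cinner mu Omega g f =
    (nu^-1 * \int[mu]_(x in Omega) (u x * Normc.normc (g x)))%:C); last first.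
  rewrite /cinner /cintegral; congr Complex.
    under eq_Rintegral do rewrite gf /=.
    by rewrite RintegralZl.
  under eq_Rintegral do rewrite gf /=.
  by rewrite Rintegral_cst// mul0r.
rewrite normcR ger0_norm; last by rewrite mulr_ge0 ?invr_ge0// ltW.
by rewrite EFinM lee_pdivrMl.
Qed.

End bl_bounded.

(** * The Hahn-Banach theorem in finite dimension *)

Section hahn_banach.
Context {R : realType}.

(** One inequality suffices for homogeneity: the reverse one follows by scaling back with the
    inverse of [t]. *)
Definition sublinear {V : lmodType R} (p : V -> R) :=
  (forall x y, p (x + y) <= p x + p y) /\
  (forall (t : R) x, 0 <= t -> p (t *: x) <= t * p x).

Section sublinear_theory.
Context {V : lmodType R}.
Implicit Types (p q : V -> R) (u v x : V).

Lemma sublinear0 p : sublinear p -> p 0 = 0.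
Proof.
move=> [pD pZ]; apply/eqP; rewrite eq_le; apply/andP; split.
  by have := pZ 0 0 (lexx _); rewrite scale0r mul0r.
by have := pD 0 0; rewrite addr0 lerDr.
Qed.

Lemma sublinearZ p t x : sublinear p -> 0 <= t -> p (t *: x) = t * p x.
Proof.
move=> sp; rewrite le_eqVlt => /predU1P[<-|t0].
  by rewrite scale0r mul0r sublinear0.
apply/eqP; rewrite eq_le sp.2 ?(ltW t0)//= -ler_pdivlMl//.
by apply: le_trans (sp.2 _ _ _); rewrite ?invr_ge0 ?(ltW t0)// scalerK// gt_eqF.
Qed.

Lemma sublinearN p x : sublinear p -> - p (- x) <= p x.
Proof.
by move=> sp; rewrite lerNl -subr_ge0 opprK -(sublinear0 sp) -(addNr x) sp.1.
Qed.

(* The last inequality makes [q] linear along [v]; doing this along every vector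
   of a basis turns a sublinear map into a linear one. *)
Lemma sublinear_shrink p v : sublinear p ->
  exists q, [/\ sublinear q, forall x, q x <= p x & q (- v) <= - p v].
Proof.
(* The new map sends [x] to the infimum of [S x], finite by [lbS]. Taking [t = 0] shows that it is
   below [p]; taking [t = 1] at [- v] gives the last inequality. *)
move=> sp; pose S x := [set p (x + t *: v) - t * p v | t in [set t : R | 0 <= t]].
have lbS x : lbound (S x) (- p (- x)).
  move=> _ [t t0 <-]; rewrite -(sublinearZ v sp t0) lerBrDl -lerBrDr opprK.
  by apply: le_trans (sp.1 _ _); rewrite addrAC subrr add0r.
have infS x : has_inf (S x).
  by split; [exists (p (x + 0 *: v) - 0 * p v), 0 => //=|exists (- p (- x))].
have infle x t : 0 <= t -> inf (S x) <= p (x + t *: v) - t * p v.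
  by move=> t0; apply: ge_inf; [exact: (infS x).2|exists t].
exists (fun x => inf (S x)); split.
- split=> [x y|t x].
    rewrite -lerBlDr; apply: lb_le_inf; first exact: (infS x).1.
    move=> _ [t t0 <-]; rewrite lerBlDl -lerBlDr.
    apply: lb_le_inf; first exact: (infS y).1.
    move=> _ [s s0 <-]; rewrite lerBlDr.
    apply: (le_trans (infle _ (t + s) _)); first exact: addr_ge0.
    rewrite scalerDl addrACA (le_trans (lerD (sp.1 _ _) (lexx _)))//.
    by rewrite le_eqVlt; apply/orP; left; apply/eqP; ring.
  rewrite le_eqVlt => /predU1P[<-|t0].
    rewrite scale0r mul0r; apply: le_trans (infle _ 0 (lexx _)) _.
    by rewrite scale0r addr0 mul0r subr0 sublinear0.
  rewrite -ler_pdivrMl//; apply: lb_le_inf; first exact: (infS x).1.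
  move=> _ [s s0 <-]; rewrite ler_pdivrMl//.
  apply: le_trans (infle _ (t * s) _) _.
    by apply: mulr_ge0 => //; exact: ltW.
  by rewrite -scalerA -scalerDr sublinearZ ?(ltW t0)// mulrBr mulrA.
- by move=> x; have := infle x 0 (lexx _); rewrite scale0r addr0 mul0r subr0.
- have := infle (- v) 1 ler01.
  by rewrite scale1r addNr mul1r sublinear0// sub0r.
Qed.

(** Further shrinking keeps what was gained: [q (- v) <= - p v] and [r <= q <= p] give
    [r (- v) <= - r v], and the reverse inequality is sublinearity. *)
Lemma sublinear_shrink_seq p (s : seq V) : sublinear p ->
  exists q, [/\ sublinear q, forall x, q x <= p x &
    forall v, v \in s -> q (- v) = - q v].
Proof.
elim: s p => [|v s ih] p sp; first by exists p; split.
have [q [sq qp qv]] := sublinear_shrink v sp.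
have [r [sr rq rs]] := ih _ sq.
exists r; split => //; first by move=> x; exact: le_trans (rq x) (qp x).
move=> w; rewrite inE => /predU1P[->|]; last exact: rs.
apply/eqP; rewrite eq_le; apply/andP; split; last first.
  by have := sublinearN (- v) sr; rewrite opprK.
rewrite (le_trans (rq _))// (le_trans qv)// lerN2.
exact: le_trans (rq v) (qp v).
Qed.

End sublinear_theory.

(** Shrinking along [v] first freezes the value there: a sublinear [q] below [p'] has
    [q v >= - q (- v) >= - p' (- v) >= p v]. Shrinking along the elementary matrices then makes [q]
    linear. *)
Lemma hahn_banach_mx (m n : nat) (p : 'M[R]_(m, n) -> R) (v : 'M[R]_(m, n)) :
  sublinear p -> exists c : 'M[R]_(m, n),
    (forall x : 'M[R]_(m, n), \sum_i \sum_j x i j * c i j <= p x) /\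
    \sum_i \sum_j v i j * c i j = p v.
Proof.
move=> sp; have [p' [sp' p'p p'v]] := sublinear_shrink v sp.
have [q [sq qp' qN]] := sublinear_shrink_seq
  [seq delta_mx ij.1 ij.2 | ij <- enum {: 'I_m * 'I_n}] sp'.
have qNd i j : q (- delta_mx i j) = - q (delta_mx i j).
  by apply: qN; apply/mapP; exists (i, j); rewrite ?mem_enum.
pose f (x : 'M[R]_(m, n)) := \sum_i \sum_j x i j * q (delta_mx i j).
have qZ (t : R) i j : q (t *: delta_mx i j) = t * q (delta_mx i j).
  have [t0|t0] := leP 0 t; first exact: sublinearZ.
  rewrite -[t]opprK scaleNr -scalerN sublinearZ ?oppr_ge0 ?ltW// qNd.
  by rewrite mulrN !mulNr opprK.
have qsum (I : Type) (s : seq I) (F : I -> 'M[R]_(m, n)) :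
    q (\sum_(i <- s) F i) <= \sum_(i <- s) q (F i).
  elim/big_ind2 : _ => [|x a y b xa yb|//]; first by rewrite sublinear0.
  by rewrite (le_trans (sq.1 _ _))// lerD.
(* Subadditivity on the expansion of [x] gives only [q <= f]; since [f] is odd, the same inequality
   at [- x] gives [f <= q]. *)
have qf x : q x <= f x.
  rewrite [x in q x]matrix_sum_delta (le_trans (qsum _ _ _))//.
  apply: ler_sum => i _; rewrite (le_trans (qsum _ _ _))//.
  by apply: ler_sum => j _; rewrite qZ.
have fN x : f (- x) = - f x.
  rewrite -sumrN; apply: eq_bigr => i _; rewrite -sumrN.
  by apply: eq_bigr => j _; rewrite mxE mulNr.
have fq x : f x <= q x.
  by rewrite -[f x]opprK -fN (le_trans _ (sublinearN _ sq))// lerN2.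
exists (\matrix_(i, j) q (delta_mx i j)).
have fE (x : 'M[R]_(m, n)) :
    \sum_i \sum_j x i j * (\matrix_(i, j) q (delta_mx i j)) i j = f x.
  by apply: eq_bigr => i _; apply: eq_bigr => j _; rewrite mxE.
split=> [x|]; first by rewrite fE (le_trans (fq x))// (le_trans (qp' x)).
rewrite fE; apply/eqP; rewrite eq_le; apply/andP; split.
  by rewrite (le_trans (fq v))// (le_trans (qp' v)).
rewrite (le_trans _ (qf v))// (le_trans _ (sublinearN _ sq))// lerNr.
exact: le_trans (qp' _) p'v.
Qed.

End hahn_banach.

(** * Series with non-negative weights over nested finite index sets *)

Lemma big_uniq_sub (R : zmodType) (I : eqType) (s t : seq I) (F : I -> R) :
  uniq s -> uniq t -> {subset s <= t} ->
  \sum_(i <- t) F i = \sum_(i <- s) F i + \sum_(i <- t | i \notin s) F i.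
Proof.
move=> us ut st; rewrite (bigID (mem s))/=; congr (_ + _).
rewrite -big_filter; apply: perm_big; apply: uniq_perm => //.
  exact: filter_uniq.
move=> i; rewrite mem_filter; apply/idP/idP => [/andP[]//|si].
by rewrite si st.
Qed.

Lemma nondecreasing_nested_sum (R : realType) (I : eqType) (S : nat -> seq I)
    (c : I -> R) :
  (forall m, uniq (S m)) ->
  (forall m p, (m <= p)%N -> {subset S m <= S p}) -> (forall i, 0 <= c i) ->
  nondecreasing_seq (fun m => \sum_(i <- S m) c i).
Proof.
move=> uS subS c0 m p mp.
by rewrite (big_uniq_sub _ (uS m) (uS p) (subS _ _ mp)) lerDl sumr_ge0.
Qed.

Section bl_series.
Context {disp : measure_display} {T : measurableType disp} {R : realType}.
Context {mu : {measure set T -> \bar R}} {Omega : set T}.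
Variable X : banach_lattice mu Omega.
Context {I : eqType}.
Variables (S : nat -> seq I) (w k : I -> R) (G : I -> T -> R[i]) (K : R).
Hypothesis S_uniq : forall m, uniq (S m).
Hypothesis S_sub : forall m p, (m <= p)%N -> {subset S m <= S p}.
Hypothesis w_ge0 : forall i, 0 <= w i.
Hypothesis wk_le : forall m, \sum_(i <- S m) w i * k i <= K.

Local Notation H m x := (\sum_(i <- S m) w i * Normc.normc (G i x)).

Let c_ge0 x i : 0 <= w i * Normc.normc (G i x).
Proof. by rewrite mulr_ge0 ?normc_ge0. Qed.

Let H_ge0 m x : 0 <= H m x.
Proof. exact: sumr_ge0. Qed.

Let H_homo x := nondecreasing_nested_sum S_uniq S_sub (c_ge0 x).

(** The increments of [H] are bounded in norm by those of the scalar sums of [w i * k i], which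
    increase and stay below [K]. So [H] is an increasing Cauchy sequence in [X]. *)
Lemma bl_series_dominated :
  (forall i, bl_mem X (G i)) -> (forall i, bl_norm X (G i) <= k i) ->
  exists h, [/\ bl_mem X h, bl_norm X h <= K &
    forall m, {ae mu, forall x, Omega x -> H m x <= Normc.normc (h x)}].
Proof.
move=> XG Gk.
have k0 i : 0 <= k i by apply: le_trans (Gk i); exact: bl_norm_ge0.
have XF i : bl_mem X (fun x => (w i)%:C * (Normc.normc (G i x))%:C).
  by apply: bl_scale; exact: bl_abs.
pose F i x := (w i)%:C * (Normc.normc (G i x))%:C.
have nF i : bl_norm X (fun x => (w i)%:C * (Normc.normc (G i x))%:C) <= w i * k i.
  rewrite bl_normZ; last exact: bl_abs.
  by rewrite normcR ger0_norm// bl_norm_abs// ler_wpM2l.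
have HE m : (fun x => (H m x)%:C) =
    fun x => \sum_(i <- S m) (w i)%:C * (Normc.normc (G i x))%:C.
  apply/funext => x; rewrite rmorph_sum; apply: eq_bigr => i _.
  by rewrite rmorphM.
have XH m : bl_mem X (fun x => (H m x)%:C) by rewrite HE; exact: bl_mem_sum.
pose s m : R := \sum_(i <- S m) w i * k i.
have diff m p : (m <= p)%N -> bl_norm X (fun x => (H p x - H m x)%:C) <= s p - s m.
  move=> mp; rewrite (_ : (fun x => _) =
      fun x => \sum_(i <- S p | i \notin S m) (w i)%:C * (Normc.normc (G i x))%:C).
    have /le_trans := @bl_norm_sum _ _ _ _ _ X _ (S p)
      (fun i => i \notin S m) F (fun i _ => XF i).
    apply.
    rewrite /s (big_uniq_sub _ (S_uniq m) (S_uniq p) (S_sub mp)) addrAC subrr add0r.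
    by apply: ler_sum => i _; exact: nF.
  apply/funext => x.
  rewrite (big_uniq_sub _ (S_uniq m) (S_uniq p) (S_sub mp)) addrAC subrr add0r.
  by rewrite rmorph_sum; apply: eq_bigr => i _; rewrite rmorphM.
apply: (@bl_nondecreasing_dominated _ _ _ _ _ X (fun m x => H m x)).
- exact: XH.
- by move=> m p x mp _; exact: H_homo.
- move=> e e0.
  have sS : has_sup (range s).
    by split; [exists (s 0%N), 0%N|exists K => _ [m _ <-]; exact: wk_le].
  have s_sup m : s m <= sup (range s).
    by apply: ub_le_sup; [exact: sS.2|exists m].
  have s_homo : nondecreasing_seq s.
    by apply: nondecreasing_nested_sum => // i; exact: mulr_ge0.
  (* From [M] on, the scalar sums lie within [e] of their supremum, hence of each other. *)
  have [_ [M _ <-] sM] := sup_adherent e0 sS.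
  exists M => m p Mm Mp.
  have := s_sup m; have := s_sup p; have := s_homo _ _ Mm; have := s_homo _ _ Mp.
  have [mp|/ltnW pm] := leqP m p => Mp' Mm' sp sm.
    rewrite (_ : (fun x => _) = fun x => - (H p x - H m x)%:C); last first.
      by apply/funext => x; rewrite -rmorphN opprB.
    rewrite bl_normN; last exact: bl_memRB.
    by apply: (le_lt_trans (diff _ _ mp)); lra.
  by apply: (le_lt_trans (diff _ _ pm)); lra.
- move=> m; rewrite HE.
  have /le_trans := @bl_norm_sum _ _ _ _ _ X _ (S m) xpredT F (fun i _ => XF i).
  apply.
  by apply: le_trans (wk_le m); apply: ler_sum => i _; exact: nF.
Qed.

Hypothesis mOmega : measurable Omega.
Hypothesis Omega_fin : (mu Omega < +oo)%E.

(** No limit in [X'] is taken: Hölder's inequality bounds each term integrated against [u], and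
    monotone convergence handles the sum. The pointwise limit may be infinite, hence the extended
    reals. *)
Lemma assoc_series_hoelder (u v : T -> R) (c : R) :
  (forall i, assoc_mem X (G i)) -> (forall i, (assoc_norm X (G i) <= (k i)%:E)%E) ->
  measurable_fun Omega u -> (forall x, Omega x -> 0 <= u x <= c) ->
  measurable_fun Omega v -> (forall x, Omega x -> 0 <= v x) ->
  (forall x, Omega x -> ((v x)%:E <= limn (fun m => (u x * H m x)%:E))%E) ->
  (\int[mu]_(x in Omega) (v x)%:E <= (bl_norm X (fun x => (u x)%:C) * K)%:E)%E.
Proof.
move=> XG Gk mu' uc mv v0 vH.
set nu := bl_norm X _.
have u0 x : Omega x -> 0 <= u x by move=> /uc /andP[].
have nu0 : 0 <= nu.
  apply: bl_norm_ge0; apply: (@bl_memR_bounded _ _ _ _ _ mOmega Omega_fin X _ c) => //.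
  by move=> x Ox; have /andP[? ?] := uc _ Ox; rewrite ger0_norm.
have mG i : measurable_fun Omega (fun x => u x * Normc.normc (G i x)).
  by apply: measurable_funM => //; have [mg _ _] := XG i; exact: measurable_fun_normc.
have mH m : measurable_fun Omega (fun x => (u x * H m x)%:E).
  apply/measurable_EFinP; apply: measurable_funM => //.
  apply: measurable_sum => i; apply: measurable_funM; first exact: measurable_cst.
  by have [mg _ _] := XG i; exact: measurable_fun_normc.
have H0 m x : Omega x -> (0 <= (u x * H m x)%:E)%E.
  by move=> Ox; rewrite lee_fin mulr_ge0 ?u0 ?H_ge0.
have ndH x : Omega x ->
    {homo (fun m => (u x * H m x)%:E) : m p / (m <= p)%N >-> (m <= p)%E}.
  by move=> Ox m p mp; rewrite lee_fin ler_wpM2l ?u0//; exact: H_homo.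
have IH m : (\int[mu]_(x in Omega) (u x * H m x)%:E <= (nu * K)%:E)%E.
  under eq_integral do rewrite mulr_sumr -sumEFin.
  rewrite ge0_integral_sum//; last 2 first.
  - move=> i; apply/measurable_EFinP; under eq_fun do rewrite mulrCA.
    by apply: measurable_funM => //; exact: measurable_cst.
  - by move=> i x Ox; rewrite lee_fin !mulr_ge0 ?u0 ?normc_ge0.
  apply: (@le_trans _ _ (\sum_(i <- S m) (nu * (w i * k i))%:E)%E).
    apply: lee_sum => i _.
    under eq_integral do rewrite mulrCA EFinM.
    rewrite ge0_integralZl//; last 3 first.
    - by apply/measurable_EFinP.
    - by move=> x Ox; rewrite lee_fin mulr_ge0 ?u0 ?normc_ge0.
    - by rewrite lee_fin.
    rewrite mulrCA EFinM; apply: lee_wpmul2l; first by rewrite lee_fin.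
    apply: (le_trans (assoc_hoelder mOmega Omega_fin (XG i) mu' uc)).
    by rewrite EFinM; apply: lee_wpmul2l => //; rewrite lee_fin.
  by rewrite sumEFin lee_fin -mulr_sumr ler_wpM2l.
apply: (@le_trans _ _
  (\int[mu]_(x in Omega) limn (fun m => (u x * H m x)%:E))%E).
  apply: ge0_le_integral => //.
  - by apply/measurable_EFinP.
  - apply: emeasurable_fun_cvg mH _ => x Ox.
    by apply: ereal_nondecreasing_is_cvgn; exact: ndH.
rewrite monotone_convergence//; apply: lime_le; last exact: nearW.
apply: ereal_nondecreasing_is_cvgn => m p mp; apply: ge0_le_integral => //.
  by move=> x Ox; exact: H0.
by move=> x Ox; exact: ndH.
Qed.

End bl_series.

(** * Linearity of the complex integral and of the inner product *)

Section complex_integral.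
Context {disp : measure_display} {T : measurableType disp} {R : realType}.
Context {mu : {measure set T -> \bar R}} {Omega : set T}.
Hypothesis mOmega : measurable Omega.
Implicit Types (f g h : T -> R[i]) (a : R[i]).

Lemma cintegrable0 : cintegrable mu Omega (fun=> 0).
Proof. by split; exact: integrable0. Qed.

Lemma cintegrableD f g : cintegrable mu Omega f -> cintegrable mu Omega g ->
  cintegrable mu Omega (fun x => f x + g x).
Proof.
move=> [fR fI] [gR gI]; split.
  apply: eq_integrable (integrableD mOmega fR gR) => // x _ /=.
  by rewrite raddfD.
apply: eq_integrable (integrableD mOmega fI gI) => // x _ /=.
by rewrite raddfD.
Qed.

Lemma cintegralD f g : cintegrable mu Omega f -> cintegrable mu Omega g ->
  cintegral mu Omega (fun x => f x + g x) =
  cintegral mu Omega f + cintegral mu Omega g.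
Proof.
move=> [fR fI] [gR gI]; rewrite /cintegral; congr Complex.
  rewrite -RintegralD//; apply: eq_Rintegral => x _; exact: raddfD.
rewrite -RintegralD//; apply: eq_Rintegral => x _; exact: raddfD.
Qed.

Lemma ReM a b : complex.Re (a * b : R[i]) =
  complex.Re a * complex.Re b - complex.Im a * complex.Im b.
Proof. by case: a b => ? ? [? ?]. Qed.

Lemma ImM a b : complex.Im (a * b : R[i]) =
  complex.Re a * complex.Im b + complex.Im a * complex.Re b.
Proof. by case: a b => ? ? [? ?] /=. Qed.

Lemma cintegrableZ a f : cintegrable mu Omega f ->
  cintegrable mu Omega (fun x => a * f x).
Proof.
move=> [fR fI]; split.
  have := integrableB mOmega (integrableZl mOmega (complex.Re a) fR)
    (integrableZl mOmega (complex.Im a) fI).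
  by apply: eq_integrable => // x _ /=; rewrite ReM.
have := integrableD mOmega (integrableZl mOmega (complex.Re a) fI)
  (integrableZl mOmega (complex.Im a) fR).
by apply: eq_integrable => // x _ /=; rewrite ImM.
Qed.

Lemma cintegralZ a f : cintegrable mu Omega f ->
  cintegral mu Omega (fun x => a * f x) = a * cintegral mu Omega f.
Proof.
move=> [fR fI]; rewrite /cintegral.
rewrite [a in RHS]complexE /=.
have ZI := integrableZl mOmega _ fI; have ZR := integrableZl mOmega _ fR.
apply/eqP; rewrite eq_complex !ReM !ImM/= !mul0r !mul1r !(subr0, add0r, addr0).
apply/andP; split; apply/eqP.
  rewrite -!RintegralZl// -RintegralB//; last 2 first.
  - exact: ZR.
  - exact: ZI.
  by apply: eq_Rintegral => x _; rewrite ReM.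
rewrite -!RintegralZl// -RintegralD//; last 2 first.
- exact: ZI.
- exact: ZR.
by apply: eq_Rintegral => x _; rewrite ImM.
Qed.

Lemma cintegral_conjc f : cintegrable mu Omega f ->
  cintegral mu Omega (fun x => conjc (f x)) = conjc (cintegral mu Omega f).
Proof.
move=> [fR fI]; rewrite /cintegral /=; congr Complex.
  by apply: eq_Rintegral => x _; case: (f x).
rewrite -mulN1r -RintegralZl//; apply: eq_Rintegral => x _.
by rewrite mulN1r; case: (f x).
Qed.

Lemma cinner_conjc f g : cintegrable mu Omega (fun x => f x * conjc (g x)) ->
  cinner mu Omega g f = conjc (cinner mu Omega f g).
Proof.
move=> /cintegral_conjc <-; rewrite /cinner; congr cintegral.
by apply/funext => x; rewrite rmorphM/= conjcK mulrC.
Qed.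

Lemma cinner_suml (I : Type) (s : seq I) (a : I -> R[i]) (F : I -> T -> R[i]) f :
  (forall i, cintegrable mu Omega (fun x => F i x * conjc (f x))) ->
  cinner mu Omega (fun x => \sum_(i <- s) a i * F i x) f =
  \sum_(i <- s) a i * cinner mu Omega (F i) f.
Proof.
move=> Ff; have aFf i := cintegrableZ (a i) (Ff i).
rewrite /cinner; elim: s => [|i s ih].
  rewrite big_nil (_ : (fun x => _) = fun=> 0).
    by rewrite /cintegral /= Rintegral_cst// mul0r.
  by apply/funext => x; rewrite big_nil mul0r.
rewrite big_cons -ih -cintegralZ// -cintegralD//.
  congr cintegral; apply/funext => x.
  by rewrite big_cons mulrDl mulrA.
elim: s {ih} => [|j s ih].
  rewrite (_ : (fun x => _) = fun=> 0); first exact: cintegrable0.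
  by apply/funext => x; rewrite big_nil mul0r.
rewrite (_ : (fun x => _) = fun x => a j * (F j x * conjc (f x)) +
  (\sum_(i <- s) a i * F i x) * conjc (f x)); first exact: cintegrableD.
by apply/funext => x; rewrite big_cons mulrDl mulrA.
Qed.

End complex_integral.

(** * Norming functionals represented by elements of [Psi] *)

Lemma Psi_psi {T : Type} {R : realType} (psi : nat -> T -> R[i]) (n : nat)
    (k : 'I_n.+1) : Psi psi n (psi k).
Proof.
exists (fun j => (j == k)%:R); apply/funext => x.
rewrite (bigD1 k)//= eqxx mul1r big1 ?addr0// => j /negbTE ->.
by rewrite mul0r.
Qed.

Section duality.
Context {disp : measure_display} {T : measurableType disp} {R : realType}.
Context {mu : {measure set T -> \bar R}} {Omega : set T}.
Hypothesis mOmega : measurable Omega.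
Variable X : banach_lattice mu Omega.
Variables (psi : nat -> T -> R[i]) (n : nat) (C1 : R).
Hypothesis psi_ortho :
  forall j k, cinner mu Omega (psi j) (psi k) = (j == k)%:R.
Hypothesis Psi_X : Psi psi n `<=` bl_mem X.
Hypothesis Psi_X' : Psi psi n `<=` assoc_mem X.
Hypothesis Sn_bounded : forall g, bl_mem X g ->
  bl_norm X (partial_sum mu Omega psi n g) <= C1 * bl_norm X g.
Implicit Types (f g : T -> R[i]).

Let comb (a : 'I_n.+1 -> R[i]) : T -> R[i] :=
  fun x => \sum_(k < n.+1) a k * psi k x.

Lemma cinner_comb (a : 'I_n.+1 -> R[i]) f : bl_mem X f ->
  cinner mu Omega (comb a) f = \sum_(k < n.+1) a k * cinner mu Omega (psi k) f.
Proof.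
by move=> Xf; apply: cinner_suml => // k; have [_ + _] := Psi_X' (Psi_psi psi k); apply.
Qed.

Lemma cinner_psi_conjc (k : 'I_n.+1) f : bl_mem X f ->
  cinner mu Omega f (psi k) = conjc (cinner mu Omega (psi k) f).
Proof.
move=> Xf; apply: cinner_conjc => //.
by have [_ + _] := Psi_X' (Psi_psi psi k); apply.
Qed.

(** Multiplying [f] by the unimodular number [z / |z|] keeps its norm and changes the inner product
    [z] into [|z|], so real parts suffice. *)
Lemma assoc_norm_le_Re g (C : R) : assoc_mem X g -> 0 <= C ->
  (forall f, bl_mem X f -> complex.Re (cinner mu Omega g f) <= C * bl_norm X f) ->
  (assoc_norm X g <= C%:E)%E.
Proof.
move=> [_ gI _] C0 gC; apply: ge_ereal_sup => _ [f [Xf f1] <-]; rewrite lee_fin.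
set z := cinner mu Omega g f.
have [->|z0] := eqVneq (Normc.normc z) 0; first by [].
pose t := z * ((Normc.normc z)^-1)%:C.
have tf : bl_mem X (fun x => t * f x) by exact: bl_scale.
have := gC _ tf; rewrite bl_normZ//.
have -> : Normc.normc t = 1.
  by rewrite Normc.normcM normcR ger0_norm ?invr_ge0 ?normc_ge0// mulfV.
rewrite mul1r (_ : cinner mu Omega g _ = (Normc.normc z)%:C).
  by move=> /le_trans; apply; rewrite -[leRHS]mulr1 ler_wpM2l.
rewrite /cinner (_ : (fun x => _) = fun x => conjc t * (g x * conjc (f x))).
  rewrite cintegralZ//; last exact: gI.
  rewrite -/(cinner mu Omega g f) -/z /t conjcM conjc_real mulrAC mulrC.
  rewrite [_ * z]mulrC mulc_conjc -(rmorphM (real_complex R)).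
  by congr (_%:C); rewrite expr2 mulKf.
by apply/funext => x; rewrite conjcM mulrCA.
Qed.

(** A real-linear functional of the coefficients [b] is the real part of the sum of
    [q k * conjc (b k)], which is a pairing with [Q = comb q]. On the Fourier coefficients of [f] it
    is at most the norm of the partial sum of [f], hence at most [C1] times the norm of [f]. *)
Lemma norming_functional P : 0 <= C1 -> Psi psi n P ->
  exists Q, [/\ Psi psi n Q, (assoc_norm X Q <= C1%:E)%E &
    bl_norm X P = complex.Re (cinner mu Omega Q P)].
Proof.
move=> C10 hP; have [a PE] := hP.
(* Complex coefficients become real matrices, with one row of real and one of imaginary parts. *)
pose z (x : 'M[R]_(2, n.+1)) (k : 'I_n.+1) : R[i] := Complex (x 0 k) (x 1 k).
pose mx (b : 'I_n.+1 -> R[i]) : 'M[R]_(2, n.+1) :=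
  \matrix_(i, k) if i == 0 then complex.Re (b k) else complex.Im (b k).
have mxK b : z (mx b) = b.
  by apply/funext => k; rewrite /z !mxE/=; case: (b k).
have Xcomb b : bl_mem X (comb b) by apply: Psi_X; exists b.
have [|c [c_le cP]] := @hahn_banach_mx R 2 n.+1
    (fun x => bl_norm X (comb (z x))) (mx a).
  split=> [x y|t x t0].
    rewrite (_ : comb (z (x + y)) = fun w => comb (z x) w + comb (z y) w).
      exact: bl_normD.
    apply/funext => w; rewrite -big_split; apply: eq_bigr => k _ /=.
    by rewrite -mulrDl; congr (_ * _); rewrite /z !mxE.
  rewrite (_ : comb (z (t *: x)) = fun w => t%:C * comb (z x) w).
    by rewrite bl_normZ// normcR ger0_norm.
  apply/funext => w; rewrite mulr_sumr; apply: eq_bigr => k _ /=.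
  by rewrite mulrA; congr (_ * _); rewrite /z !mxE; simpc.
pose q := z c.
have ReE b : \sum_i \sum_k mx b i k * c i k =
    complex.Re (\sum_(k < n.+1) q k * conjc (b k)).
  rewrite big_ord_recl big_ord1 -big_split raddf_sum; apply: eq_bigr => k _ /=.
  rewrite !mxE /= ReM /q /z /=; case: (b k) => r i /=.
  by rewrite (_ : lift _ _ = 1); [ring|exact/val_inj].
have XQ : Psi psi n (comb q) by exists q.
exists (comb q); split => //.
- apply: assoc_norm_le_Re => //; first exact: Psi_X'.
  move=> f Xf; rewrite cinner_comb//.
  (* With these coefficients [comb b] is the partial sum of [f]. *)
  pose b (k : 'I_n.+1) := cinner mu Omega f (psi k).
  have := c_le (mx b); rewrite ReE mxK.
  rewrite (_ : \sum_k _ = \sum_(k < n.+1) q k * cinner mu Omega (psi k) f).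
    by move=> /le_trans; apply; exact: Sn_bounded.
  by apply: eq_bigr => k _; rewrite /b cinner_psi_conjc// conjcK.
- rewrite cinner_comb; last exact: Psi_X.
  rewrite [P in LHS]PE -/(comb a) -[a in LHS]mxK -cP ReE; congr complex.Re.
  apply: eq_bigr => k _; congr (_ * _).
  have Xk : bl_mem X (psi k) by by apply: Psi_X; exact: Psi_psi.
  have XP := Psi_X hP.
  (* By orthonormality the coefficients [a] of [P] are its Fourier coefficients. *)
  rewrite -[RHS]conjcK -cinner_psi_conjc//; congr conjc.
  rewrite PE -/(comb a) cinner_comb// (bigD1 k)//= psi_ortho eqxx mulr1.
  rewrite big1 ?addr0// => j jk; rewrite psi_ortho.
  by rewrite (negbTE (_ : (j : nat) != k)) ?mulr0//; exact: jk.
Qed.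

End duality.

(** * Multi-indices of bounded degree *)

Section multi_indices.
Context {d : nat}.
Implicit Types (a : {ffun 'I_d -> nat}).

(** The index set of [taylor_poly] as a duplicate-free list, increasing with [m], as the series
    lemmas require. *)
Definition mindices (m : nat) : seq {ffun 'I_d -> nat} :=
  [seq [ffun i => nat_of_ord (b i)] | b : {ffun 'I_d -> 'I_m.+1} <-
    [seq b : {ffun 'I_d -> 'I_m.+1} <- enum {: {ffun 'I_d -> 'I_m.+1}} |
      (\sum_(i < d) b i <= m)%N]].

Lemma mindices_uniq m : uniq (mindices m).
Proof.
rewrite map_inj_uniq ?filter_uniq -?enumT ?enum_uniq// => b b' /ffunP bb'.
by apply/ffunP => i; apply/val_inj; have := bb' i; rewrite !ffunE.
Qed.

Lemma mem_mindices m a : (a \in mindices m) = (mdeg a <= m)%N.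
Proof.
apply/mapP/idP => [[b]|am].
  rewrite mem_filter => /andP[bm _] ->; rewrite /mdeg.
  by under eq_bigr do rewrite ffunE.
have ai i : (a i < m.+1)%N.
  by rewrite ltnS (leq_trans _ am)// /mdeg (bigD1 i)//= leq_addr.
exists [ffun i => Ordinal (ai i)]; last by apply/ffunP => i; rewrite !ffunE.
rewrite mem_filter mem_enum andbT.
by under eq_bigr do rewrite ffunE.
Qed.

Lemma mindices_sub m p : (m <= p)%N -> {subset mindices m <= mindices p}.
Proof. by move=> mp a; rewrite !mem_mindices => /leq_trans; apply. Qed.

Lemma mdeg_eq0 a : mdeg a = 0%N -> a = [ffun=> 0%N].
Proof.
move=> /eqP; rewrite sum_nat_eq0 => /forallP a0; apply/ffunP => i.
by rewrite ffunE; apply/eqP; exact: (a0 i).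
Qed.

Lemma mfact_gt0 a : (0 < mfact a)%N.
Proof. by apply: prodn_gt0 => i; exact: fact_gt0. Qed.

(** Only the zero index has degree 0; the others form a finite part of the index set of the series
    [eta]. *)
Lemma sum_mindices_le {R : realType} (F : {ffun 'I_d -> nat} -> R) (eta : R) m :
  (forall a, 0 <= F a) ->
  eta%:E = (\esum_(a in [set a | mdeg a != 0%N]) (F a)%:E)%E ->
  \sum_(a <- mindices m) F a <= F [ffun=> 0%N] + eta.
Proof.
move=> F0 etaE; rewrite (bigID (fun a => mdeg a == 0%N))/=; apply: lerD.
  rewrite -big_filter (_ : [seq _ <- _ | _] = [:: [ffun=> 0%N]]) ?big_seq1//.
  apply: perm_small_eq => //; apply: uniq_perm => //.
    by rewrite filter_uniq// mindices_uniq.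
  move=> a; rewrite mem_filter mem_mindices inE.
  apply/andP/eqP => [[/eqP /mdeg_eq0 //]|->].
  by rewrite /mdeg big1// => i _; rewrite ffunE.
rewrite -lee_fin etaE -sumEFin -big_filter; apply: esum_ge.
exists [set` [seq a <- mindices m | mdeg a != 0%N]].
  split; first exact: finite_seq.
  by move=> a /=; rewrite mem_filter => /andP[].
by rewrite fsbig_seq// filter_uniq// mindices_uniq.
Qed.

End multi_indices.

(** * Taylor expansion and bounds at a nearby point *)

Section taylor.
Context {R : realType} {d : nat}.
Implicit Types (x y : 'rV[R]_d) (P : 'rV[R]_d -> R[i]) (a : {ffun 'I_d -> nat}).

Lemma taylor_poly_mindices P m x y :
  taylor_poly P m x y = \sum_(a <- mindices m) taylor_term P x y a.
Proof. by rewrite /mindices big_map big_filter big_enum_cond. Qed.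

Lemma norm_mpow_le (v : 'rV[R]_d) a (c : R) : `|v| <= c -> `|mpow v a| <= c ^+ mdeg a.
Proof.
move=> vc; rewrite /mpow normr_prod /mdeg expr_sum.
apply: ler_prod => i _; rewrite normrX exprn_ge0//= lerXn2r ?nnegrE//.
  exact: le_trans (normr_ge0 v) vc.
apply: le_trans vc; rewrite [leRHS]mx_normrE.
exact: (le_bigmax _ (fun ij : 'I_1 * 'I_d => `|v ij.1 ij.2|) (ord0, i)).
Qed.

(** The power of [phi] moves from the increment [y - x] to the derivative, where Bernstein's
    inequality applies. *)
Lemma taylor_term_le P x y a (delta phi : R) : 0 <= phi ->
  `|x - y| <= delta * phi ->
  Normc.normc (taylor_term P x y a) <= delta ^+ mdeg a / (mfact a)%:R *
    Normc.normc ((phi ^+ mdeg a)%:C * Dalpha a P x).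
Proof.
move=> phi0; rewrite distrC => /(norm_mpow_le a); rewrite exprMn => xy.
have f0 : (0 : R) < (mfact a)%:R by rewrite ltr0n mfact_gt0.
rewrite /taylor_term !Normc.normcM !normcR normrM [`|_^-1|]gtr0_norm ?invr_gt0//.
rewrite [`|phi ^+ _|]ger0_norm ?exprn_ge0//.
rewrite [leRHS](_ : _ = Normc.normc (Dalpha a P x) *
  (delta ^+ mdeg a * phi ^+ mdeg a / (mfact a)%:R)); last by ring.
by rewrite ler_wpM2l ?normc_ge0// ler_pM2r ?invr_gt0.
Qed.

(* The bound [M] makes the Taylor series converge absolutely at [y]. *)
Lemma taylor_represents_le P x y (delta phi M : R) :
  taylor_represents P x y -> 0 <= phi -> `|x - y| <= delta * phi ->
  (forall m, \sum_(a <- mindices m) delta ^+ mdeg a / (mfact a)%:R *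
     Normc.normc ((phi ^+ mdeg a)%:C * Dalpha a P x) <= M) ->
  Normc.normc (P y) <= M.
Proof.
move=> tP phi0 xy HM.
have tM m : \sum_(a <- mindices m) Normc.normc (taylor_term P x y a) <= M.
  by apply: le_trans (HM m); apply: ler_sum => a _; exact: taylor_term_le.
have {}tP : (fun m => Normc.normc (taylor_poly P m x y - P y)) @ \oo --> (0 : R).
  apply: tP; apply: (@le_lt_trans _ _ M%:E); last exact: ltry.
  apply: ge_ereal_sup => _ [A [finA _] <-].
  rewrite fsbig_finite//= sumEFin lee_fin.
  set s := finmap.enum_fset _.
  (* The total degree over the finite set bounds the degree of each member, so the set lies in
     [mindices m]. *)
  pose m := (\sum_(a <- s) mdeg a)%N.
  apply: le_trans (tM m).
  rewrite [leRHS](@big_uniq_sub _ _ s) ?mindices_uniq ?finmap.fset_uniq//.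
    by rewrite lerDl sumr_ge0// => a _; exact: normc_ge0.
  by move=> a sa; rewrite mem_mindices /m (big_rem a)//= leq_addr.
rewrite -[M]addr0; apply: (cvgr_to_ge (cvgD (@cvg_cst _ M _ \oo _) tP)).
apply: nearW => m /=.
rewrite -[P y](subKr (taylor_poly P m x y)) (le_trans (le_normcD _ _))//.
rewrite normcN subKr lerD2r taylor_poly_mindices.
exact: le_trans (ler_normc_sum _ _ _) (tM m).
Qed.
End taylor.

(** If the limit is a real [r] and [u > 0], then [r / u] bounds all [H m] and serves as [M]. An
    infinite limit is trivial, and [u = 0] is covered by its own hypothesis. *)
Lemma le_limn_scaled {R : realType} (H : nat -> R) (u v : R) : 0 <= u ->
  nondecreasing_seq H -> (forall m, 0 <= H m) ->
  (u = 0 -> v <= 0) -> (forall M, (forall m, H m <= M) -> v <= u * M) ->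
  (v%:E <= limn (fun m => (u * H m)%:E))%E.
Proof.
move=> u0 ndH H0 vu0 vH.
have nduH : nondecreasing_seq (fun m => (u * H m)%:E).
  by move=> m p mp; rewrite lee_fin ler_wpM2l// ndH.
have HL m : ((u * H m)%:E <= limn (fun m => (u * H m)%:E))%E.
  apply: lime_ge; first exact: ereal_nondecreasing_is_cvgn.
  by exists m => // p /= mp; exact: nduH.
move: HL; case: (limn _) => [r| |] HL; [|exact: leey|by have := HL 0%N].
have {}HL m : u * H m <= r by rewrite -lee_fin.
rewrite lee_fin; have [u_eq0|u_neq0] := eqVneq u 0.
  by rewrite (le_trans (vu0 u_eq0))// (le_trans _ (HL 0%N))// u_eq0 mul0r.
have u_gt0 : 0 < u by rewrite lt_def u_neq0.
rewrite -[r](mulVKf u_neq0); apply: vH => m.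
by rewrite ler_pdivlMl.
Qed.

Lemma Dalpha0 {R : realType} {d : nat} (P : 'rV[R]_d -> R[i]) :
  Dalpha [ffun=> 0%N] P = P.
Proof.
rewrite /Dalpha (_ : mindex_seq _ = [::]).
  by apply/funext => x /=; case: (P x).
rewrite /mindex_seq; elim: (enum 'I_d) => //= i s ->.
by rewrite ffunE.
Qed.

Lemma mdeg0 {d : nat} : mdeg ([ffun=> 0%N] : {ffun 'I_d -> nat}) = 0%N.
Proof. by rewrite /mdeg big1// => i _; rewrite ffunE. Qed.

(** * Discretization of the norm of [X] at the quadrature nodes *)

Theorem theorem3p1 (R : realType) (d : nat)
  (* a sigma-algebra on R^d containing the open sets *)
  (G : set (set 'rV[R]_d)) (hG : forall U : set 'rV[R]_d, open U -> <<s G >> U)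
  (mu : {measure set (g_sigma_algebraType G) -> \bar R})
  (Omega : set 'rV[R]_d)
  (Omega_neq0 : Omega !=set0) (Omega_open : open Omega)
  (Omega_connected : connected Omega)
  (mu_sigma_finite : sigma_finite (Omega : set (g_sigma_algebraType G)) mu)
  (X : banach_lattice mu Omega)
  (psi : nat -> 'rV[R]_d -> R[i])
  (psi_orthonormal : orthonormal_system mu Omega psi)
  (psi0 : forall x, Omega x -> psi 0%N x = 1)
  (n : nat) (n_gt0 : (0 < n)%N)
  (Psi_X : Psi psi n `<=` bl_mem X)
  (Psi_smooth : forall P, Psi psi n P -> smooth_on Omega P)
  (* quadrature formula for the products P * conj(Q) *)
  (N : nat) (xk : 'I_N -> 'rV[R]_d) (muk : 'I_N -> R)
  (xk_Omega : forall k, Omega (xk k)) (muk_ge0 : forall k, 0 <= muk k)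
  (quadrature : forall P Q, Psi psi n P -> Psi psi n Q ->
     cinner mu Omega P Q =
     \sum_(k < N) P (xk k) * conjc (Q (xk k)) * real_complex R (muk k))
  (* covering *)
  (Omegak : 'I_N -> set 'rV[R]_d) (c1 c2 : R)
  (Omegak_sub : forall k, Omegak k `<=` Omega)
  (Omegak_measurable : forall k, <<s G >> (Omegak k))
  (muk_le : forall k, ((muk k)%:E <= c1%:E * mu (Omegak k))%E)
  (overlap : forall x, Omega x -> \sum_(k < N) \1_(Omegak k) x <= c2)
  (* boundedness of the partial sums *)
  (C1 : R) (C1_gt0 : 0 < C1)
  (Sn_bounded : forall g, bl_mem X g ->
     bl_norm X (partial_sum mu Omega psi n g) <= C1 * bl_norm X g)
  (* Bernstein inequalities in X and X' *)
  (beta : R) (beta_gt0 : 0 < beta)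
  (phi : 'rV[R]_d -> R) (phi_ge0 : forall x, Omega x -> 0 <= phi x)
  (B : {ffun 'I_d -> nat} -> R) (B_gt0 : forall a, 0 < B a)
  (bernstein_X : forall (a : {ffun 'I_d -> nat}) P, Psi psi n P ->
     let g := fun x => real_complex R (phi x ^+ mdeg a) * Dalpha a P x in
     bl_mem X g /\
     bl_norm X g <= B a * n%:R `^ (beta * (mdeg a)%:R) * bl_norm X P)
  (bernstein_X' : forall (a : {ffun 'I_d -> nat}) P, Psi psi n P ->
     let g := fun x => real_complex R (phi x ^+ mdeg a) * Dalpha a P x in
     assoc_mem X g /\
     (assoc_norm X g <=
        (B a * n%:R `^ (beta * (mdeg a)%:R))%:E * assoc_norm X P)%E)
  (* localization of the nodes *)
  (A : R) (A_gt0 : 0 < A) (eta : R)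
  (eta_def : eta%:E =
     \esum_(a in [set a : {ffun 'I_d -> nat} | mdeg a != 0%N])
       (A ^+ mdeg a * B a / (mfact a)%:R)%:E)
  (nodes_local : forall k x, Omegak k x ->
     cube Omega x (A / n%:R `^ beta * phi x) (xk k))
  (* wherever the Taylor series of P at x converges absolutely at the node,
     it represents P there *)
  (Psi_taylor : forall P, Psi psi n P -> forall k x, Omegak k x ->
     taylor_represents P x (xk k))
  (P : 'rV[R]_d -> R[i]) (hP : Psi psi n P) :
  let F := fun x : 'rV[R]_d =>
    \sum_(k < N) `|P (xk k)| * real_complex R (\1_(Omegak k) x) in
  1 / (c2 * (1 + eta)) * bl_norm X F <= bl_norm X P /\
  bl_norm X P <= c1 * c2 * C1 * (1 + eta) * bl_norm X F.

Proof.
move=> F.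
pose T := g_sigma_algebraType G.
have mOmega : measurable (Omega : set T) by exact: hG.
have mOk k : measurable (Omegak k : set T) by exact: Omegak_measurable.
(* Since [psi 0] is 1 on [Omega], its normalization determines the measure. The real integral would
   give 0 for infinite measure, so the value 1 excludes that case. *)
have mu_Omega : mu Omega = 1%E.
  have := psi_orthonormal.2 0%N 0%N.
  rewrite /cinner /cintegral eqxx => /(congr1 (@complex.Re R))/=.
  rewrite (@eq_Rintegral _ _ _ mu Omega (fun=> 1)); last first.
    by move=> x /set_mem Ox; rewrite psi0//= oppr0 !mulr0 subr0 mulr1.
  rewrite Rintegral_cst// mul1r.
  by case: (mu Omega) => [r /= ->| |] //= /eqP; rewrite eq_sym oner_eq0.
have Omega_fin : (mu Omega < +oo)%E by rewrite mu_Omega ltry.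
have Ok_fin k : mu (Omegak k) \is a fin_num.
  rewrite ge0_fin_numE//; apply: le_lt_trans Omega_fin.
  by apply: le_measure; rewrite ?inE//; exact: Omegak_sub.
pose mk k := fine (mu (Omegak k)).
have mk_ge0 k : 0 <= mk k by exact: fine_ge0.
have muk_mk k : muk k <= c1 * mk k.
  by rewrite -lee_fin EFinM fineK.
(* The quadrature formula for the product of [psi 0] with itself. *)
have sum_muk : \sum_(k < N) muk k = 1.
  have hpsi0 := @Psi_psi _ _ psi n ord0.
  have := quadrature _ _ hpsi0 hpsi0.
  rewrite (psi_orthonormal.2 0%N 0%N) eqxx => /(congr1 (@complex.Re R)) /= ->.
  rewrite raddf_sum; apply: eq_bigr => k _ /=.
  by rewrite psi0//=; ring.
have c1_gt0 : 0 < c1.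
  rewrite ltNge; apply/negP => c1_le0; suff : (1 : R) <= 0 by rewrite ler10.
  rewrite -sum_muk; apply: sumr_le0 => k _.
  by rewrite (le_trans (muk_mk k))// mulr_le0_ge0.
(* A positive weight forces its [Omegak k] to have positive measure, hence a point, where the
   overlap is at least 1. *)
have c2_ge1 : 1 <= c2.
  have [k muk_gt0] : exists k, 0 < muk k.
    apply: contrapT => /forallNP muk_le0.
    suff : (1 : R) <= 0 by rewrite ler10.
    by rewrite -sum_muk; apply: sumr_le0 => k _; rewrite leNgt; exact/negP.
  have /set0P [x kx] : Omegak k != set0.
    apply/eqP => k0; have := muk_mk k.
    by rewrite /mk k0 measure0 mulr0 leNgt muk_gt0.
  apply: le_trans (overlap x (Omegak_sub k x kx)).
  by rewrite (bigD1 k)//= indicE mem_set// lerDl sumr_ge0.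
have c2_gt0 : 0 < c2 by exact: lt_le_trans c2_ge1.
have eta_ge0 : 0 <= eta.
  rewrite -lee_fin eta_def; apply: esum_ge0 => a _.
  by rewrite lee_fin !mulr_ge0 ?exprn_ge0 ?invr_ge0 ?(ltW A_gt0) ?(ltW (B_gt0 _)).
(* The zero index gets the constant 1 in place of [B 0], as [D^0 P = P]; this yields the 1 in
   [1 + eta]. *)
pose b (a : {ffun 'I_d -> nat}) : R := if mdeg a == 0%N then 1 else B a.
pose nb (a : {ffun 'I_d -> nat}) : R := n%:R `^ (beta * (mdeg a)%:R).
pose delta : R := A / n%:R `^ beta.
pose w (a : {ffun 'I_d -> nat}) : R := delta ^+ mdeg a / (mfact a)%:R.
pose D (Q : 'rV[R]_d -> R[i]) (a : {ffun 'I_d -> nat}) (x : 'rV[R]_d) : R[i] :=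
  (phi x ^+ mdeg a)%:C * Dalpha a Q x.
have nbeta_gt0 : 0 < n%:R `^ beta :> R by rewrite powR_gt0// ltr0n.
have w_ge0 a : 0 <= w a.
  by rewrite /w divr_ge0 ?exprn_ge0 ?divr_ge0 ?(ltW A_gt0) ?(ltW nbeta_gt0).
(* The powers of [n^beta] in the weight and in Bernstein's inequality cancel, leaving the general
   term of [eta] for non-zero [a]. *)
have wbnb a : w a * (b a * nb a) = A ^+ mdeg a * b a / (mfact a)%:R.
  rewrite /w /nb powRrM powR_mulrn ?(ltW nbeta_gt0)// /delta expr_div_n.
  have : n%:R `^ beta ^+ mdeg a != 0 :> R by rewrite gt_eqF// exprn_gt0.
  have : (mfact a)%:R != 0 :> R by rewrite pnatr_eq0 -lt0n mfact_gt0.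
  by move: (mfact a)%:R (_ ^+ _) (_ ^+ _) => f y t f0 t0; field; rewrite t0 f0.
have wk_le L m : 0 <= L ->
    \sum_(a <- mindices m) w a * (b a * nb a * L) <= (1 + eta) * L.
  move=> L0; under eq_bigr do rewrite mulrA wbnb.
  rewrite -mulr_suml ler_wpM2r//.
  pose f (a : {ffun 'I_d -> nat}) := A ^+ mdeg a * b a / (mfact a)%:R.
  rewrite [X in X + eta](_ : 1 = f [ffun=> 0%N]); last first.
    rewrite /f /b mdeg0 eqxx expr0 !mul1r /mfact big1 ?invr1// => i _.
    by rewrite ffunE.
  apply: (@sum_mindices_le _ _ f) => [a|].
    rewrite /f /b !mulr_ge0 ?exprn_ge0 ?invr_ge0 ?(ltW A_gt0)//.
    by case: ifP => // _; exact: ltW.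
  rewrite eta_def; apply: eq_esum => a /= a0.
  by rewrite /f /b (negbTE a0).
have D0 Q a : mdeg a = 0%N -> D Q a = Q.
  move=> a0; apply/funext => x; rewrite /D a0 expr0 mul1r.
  by rewrite (mdeg_eq0 a0) Dalpha0.
have nb0 a : mdeg a = 0%N -> nb a = 1 by rewrite /nb => ->; rewrite mulr0 powRr0.
have D_X Q a : Psi psi n Q ->
    bl_mem X (D Q a) /\ bl_norm X (D Q a) <= b a * nb a * bl_norm X Q.
  move=> hQ; have [a0|a0] := eqVneq (mdeg a) 0%N.
    by rewrite D0// /b a0 nb0// !mul1r; split => //; exact: Psi_X.
  by rewrite /b (negbTE a0); exact: bernstein_X.
(* Membership in [X'] is Bernstein's inequality at the zero index. *)
have Psi_X' Q : Psi psi n Q -> assoc_mem X Q.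
  by move=> hQ; rewrite -(D0 Q _ (@mdeg0 d)); have [] := bernstein_X' [ffun=> 0%N] Q hQ.
have D_X' Q a (L : R) : Psi psi n Q -> assoc_norm X Q = L%:E ->
    assoc_mem X (D Q a) /\ (assoc_norm X (D Q a) <= (b a * nb a * L)%:E)%E.
  move=> hQ QL; have [a0|a0] := eqVneq (mdeg a) 0%N.
    by rewrite D0// /b a0 nb0// !mul1r QL; split => //; exact: Psi_X'.
  rewrite /b (negbTE a0) EFinM -QL; exact: bernstein_X'.
have node_le Q k x (M : R) : Psi psi n Q -> Omegak k x ->
    (forall m, \sum_(a <- mindices m) w a * Normc.normc (D Q a x) <= M) ->
    Normc.normc (Q (xk k)) <= M.
  move=> hQ kx; apply: (@taylor_represents_le _ _ _ x _ delta (phi x)).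
  - exact: Psi_taylor.
  - exact/phi_ge0/(Omegak_sub k).
  - by have [] := nodes_local k x kx.
pose p k := Normc.normc (P (xk k)).
pose FR (x : 'rV[R]_d) : R := \sum_(k < N) p k * \1_(Omegak k) x.
have FE : F = fun x => (FR x)%:C.
  by apply/funext => x; rewrite rmorph_sum; apply: eq_bigr => k _; rewrite rmorphM.
have XF : bl_mem X F.
  apply: bl_mem_sum => k _; apply: bl_scale; apply: bl_indic => //.
  by rewrite ltey_eq Ok_fin.
have FR_ge0 x : 0 <= FR x.
  by apply: sumr_ge0 => k _; rewrite mulr_ge0 ?normc_ge0.
have nF_ge0 : 0 <= bl_norm X F by exact: bl_norm_ge0.
have nP_ge0 : 0 <= bl_norm X P by exact/bl_norm_ge0/Psi_X.
split.

(* The lower bound for the norm of [P] *)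
- have [||||||h [Xh hK Hh]] := @bl_series_dominated _ _ _ _ _ X _ mindices w
    (fun a => b a * nb a * bl_norm X P) (D P) ((1 + eta) * bl_norm X P).
  + exact: mindices_uniq.
  + exact: mindices_sub.
  + exact: w_ge0.
  + by move=> m; exact: wk_le.
  + by move=> a; have [] := D_X P a hP.
  + by move=> a; have [] := D_X P a hP.
  have Fh : bl_norm X F <= c2 * bl_norm X h.
    rewrite -[c2]ger0_norm ?(ltW c2_gt0)// -normcR -bl_normZ//.
    apply: bl_norm_le => //; first exact: bl_scale.
    apply: filterS (ae_foralln Hh) => x hx Ox.
    rewrite !complex_normE lecR FE normcR ger0_norm// Normc.normcM normcR.
    rewrite ger0_norm ?(ltW c2_gt0)//.
    (* Almost everywhere [|h x|] bounds all Taylor sums at once, hence [|P x_k|] for each [Omegak k]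
       containing [x]; there are at most [c2] such sets. *)
    apply: (@le_trans _ _ (\sum_(k < N) Normc.normc (h x) * \1_(Omegak k) x)).
      apply: ler_sum => k _; rewrite indicE.
      have [/set_mem kx|_] := boolP (x \in Omegak k); last by rewrite !mulr0.
      by rewrite !mulr1; apply: (node_le P k x _ hP kx) => m; exact: hx.
    by rewrite -mulr_sumr mulrC ler_wpM2r ?normc_ge0 ?overlap.
  rewrite div1r ler_pdivrMl; last by rewrite mulr_gt0// ltr_pwDl.
  by rewrite (le_trans Fh)// -mulrA ler_pM2l.

(* The upper bound for the norm of [P], by duality *)
have [Q [hQ Q_C1 PQ]] := norming_functional mOmega psi_orthonormal.2 Psi_X Psi_X'
  Sn_bounded (ltW C1_gt0) hP.
have [L QL] : exists L : R, assoc_norm X Q = L%:E.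
  exists (fine (assoc_norm X Q)); rewrite fineK// ge0_fin_numE ?assoc_norm_ge0//.
  by have [] := Psi_X' Q hQ.
have L_ge0 : 0 <= L by rewrite -lee_fin -QL; exact: assoc_norm_ge0.
have L_C1 : L <= C1 by rewrite -lee_fin -QL.
pose q k := Normc.normc (Q (xk k)).
have P_le : bl_norm X P <= \sum_(k < N) q k * p k * muk k.
  rewrite PQ quadrature// raddf_sum; apply: ler_sum => k _.
  apply: (le_trans (Re_le_normc _)); rewrite !Normc.normcM normc_conjc normcR.
  by rewrite ger0_norm.
(* Replacing [muk k] by the measure of [Omegak k] turns the quadrature sum into the integral of [v],
   which is at most [FR] times the sum of the Taylor bounds of [Q]. *)
pose v (x : 'rV[R]_d) : R := \sum_(k < N) q k * p k * \1_(Omegak k) x.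
have qp_ge0 k : 0 <= q k * p k by rewrite mulr_ge0 ?normc_ge0.
have mFR : measurable_fun (Omega : set T) FR.
  apply: measurable_sum => k; apply: measurable_funM; first exact: measurable_cst.
  exact: measurable_indic.
have mv : measurable_fun (Omega : set T) v.
  apply: measurable_sum => k; apply: measurable_funM; first exact: measurable_cst.
  exact: measurable_indic.
have v_int : (\int[mu]_(x in Omega) (v x)%:E = (\sum_(k < N) q k * p k * mk k)%:E)%E.
  rewrite /v; under eq_integral do rewrite -sumEFin.
  rewrite ge0_integral_sum//; last 2 first.
  - move=> k; apply/measurable_EFinP; apply: measurable_funM.
      exact: measurable_cst.
    exact: measurable_indic.
  - by move=> k x _; rewrite lee_fin mulr_ge0.
  rewrite -sumEFin; apply: eq_bigr => k _.
  under eq_integral do rewrite EFinM.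
  rewrite ge0_integralZl//; last 2 first.
  - by apply/measurable_EFinP; exact: measurable_indic.
  - by rewrite lee_fin.
  rewrite integral_indic// setIidl; last exact: Omegak_sub.
  by rewrite [RHS]EFinM fineK.
have v_le : (\int[mu]_(x in Omega) (v x)%:E <= (bl_norm X F * ((1 + eta) * L))%:E)%E.
  rewrite FE; apply: (@assoc_series_hoelder _ _ _ _ _ X _ mindices w
    (fun a => b a * nb a * L) (D Q) ((1 + eta) * L) _ _ _ _ _ _ FR v
    (\sum_(k < N) p k)) => //.
  - exact: mindices_uniq.
  - exact: mindices_sub.
  - by move=> m; exact: wk_le.
  - by move=> a; have [] := D_X' Q a L hQ QL.
  - by move=> a; have [] := D_X' Q a L hQ QL.
  - move=> x _; rewrite FR_ge0; apply: ler_sum => k _.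
    by rewrite ler_piMr ?normc_ge0// indicE; case: (_ \in _).
  - by move=> x _; apply: sumr_ge0 => k _; rewrite mulr_ge0.
  - move=> x Ox; apply: le_limn_scaled => //.
    + apply: nondecreasing_nested_sum mindices_uniq mindices_sub _ => a.
      by rewrite mulr_ge0 ?normc_ge0.
    + by move=> m; apply: sumr_ge0 => a _; rewrite mulr_ge0 ?normc_ge0.
    (* Where [FR] vanishes so does each of its non-negative terms, and with them [v]. *)
    + move=> /eqP; rewrite psumr_eq0; last first.
        by move=> k _; rewrite mulr_ge0 ?normc_ge0.
      move=> /allP F0; rewrite /v big1// => k _.
      by rewrite -mulrA (eqP (F0 k (mem_index_enum k))) mulr0.
    + move=> M HM; rewrite /v /FR mulr_suml; apply: ler_sum => k _; rewrite indicE.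
      have [/set_mem kx|_] := boolP (x \in Omegak k); last by rewrite !mulr0 mul0r.
      rewrite !mulr1 mulrC ler_wpM2l ?normc_ge0//.
      exact: (node_le Q k x _ hQ kx).
rewrite v_int lee_fin in v_le.
apply: (le_trans P_le).
apply: (@le_trans _ _ (c1 * \sum_(k < N) q k * p k * mk k)).
  rewrite mulr_sumr; apply: ler_sum => k _.
  by rewrite mulrCA ler_wpM2l.
apply: (@le_trans _ _ (c1 * (bl_norm X F * ((1 + eta) * C1)))).
  rewrite ler_pM2l// (le_trans v_le)// !ler_wpM2l// ?addr_ge0//.
(* The factor [c2 >= 1] is inserted here. *)
rewrite [leRHS](_ : _ = c2 * (c1 * (bl_norm X F * ((1 + eta) * C1)))); last by ring.
by rewrite ler_peMl// !mulr_ge0 ?addr_ge0 ?(ltW c1_gt0) ?(ltW C1_gt0).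
Qed.
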